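(* Let $G=(V,E)$ be a connected weighted graph on $n$ vertices whose edge weights come from a finite known set of size $s$. Suppose $k$ entries of the (weighted) adjacency matrix of $G$ are unknown while all others are known. There exists an algorithm that reconstructs $G$ (i.e., finds the $k$ missing weights) with $k$ effective resistance queries and running time $O(s^k n^{\omega})$, where $\omega$ is the matrix multiplication exponent.
   Context: The weighted adjacency matrix has $A_{uv}=w(u,v)$ for edges and $0$ otherwise; $L=D-A$ is the Laplacian. An effective resistance query on $u,v$ returns $R(u,v)=(\mathbf{1}_u-\mathbf{1}_v)^TL^+(\mathbf{1}_u-\mathbf{1}_v)$, where $L^+$ is the pseudoinverse of $L$. $\omega$ denotes the exponent such that two $n\times n$ matrices can be multiplied in $O(n^\omega)$ time. *)

(* Defs.v *)
From HB Require Import structures.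
From mathcomp Require Import all_boot all_order all_algebra.
From mathcomp Require Import boolp classical_sets reals exp.

Set Implicit Arguments.
Unset Strict Implicit.
Unset Printing Implicit Defensive.
Import Order.TTheory GRing.Theory Num.Theory.
Local Open Scope ring_scope.

Section PseudoInverse.
Variable R : realType.

(* The four Penrose conditions. [mxalgebra.pinvmx] is only a generalized
   inverse (it need not satisfy the two symmetry conditions), so it is not the
   pseudoinverse meant here. *)
Definition is_pinv m n (A : 'M[R]_(m, n)) (X : 'M[R]_(n, m)) : Prop :=
  [/\ A *m X *m A = A, X *m A *m X = X,
      (A *m X)^T = A *m X & (X *m A)^T = X *m A].

Definition pinv m n (A : 'M[R]_(m, n)) : 'M[R]_(n, m) :=
  xget 0 [set X | is_pinv A X]%classic.

Lemma is_pinv_uniq m n (A : 'M[R]_(m, n)) X Y :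
  is_pinv A X -> is_pinv A Y -> X = Y.
Proof.
move=> [x1 x2 x3 x4] [y1 y2 y3 y4].
have E1 : A *m X = A *m Y.
  rewrite -x3 -{1}y1 -mulmxA trmx_mul x3 y3 mulmxA.
  by rewrite x1.
have E2 : X *m A = Y *m A.
  rewrite -x4 -{1}y1 -!mulmxA mulmxA trmx_mul x4 y4 -mulmxA.
  by rewrite (mulmxA A) x1.
by rewrite -x2 E2 -mulmxA E1 mulmxA y2.
Qed.

Lemma gram_eq0 m n (B : 'M[R]_(m, n)) : B *m B^T = 0 -> B = 0.
Proof.
move=> H; apply/matrixP=> i j; rewrite mxE.
have /eqP := congr1 (fun M : 'M_m => M i i) H.
rewrite !mxE psumr_eq0 => [/allP /(_ j)|k _]; last by rewrite mxE -expr2 sqr_ge0.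
by rewrite mem_index_enum mxE mulf_eq0 orbb => /(_ isT) /eqP.
Qed.

Lemma gram_unit r n (F : 'M[R]_(r, n)) : row_free F -> F *m F^T \in unitmx.
Proof.
move=> fF; rewrite -row_free_unit -kermx_eq0; apply/eqP.
set K := kermx _.
have K0 : K *m (F *m F^T) = 0 by rewrite mulmx_ker.
have /gram_eq0 KF : (K *m F) *m (K *m F)^T = 0.
  by rewrite trmx_mul mulmxA -(mulmxA K) K0 mul0mx.
by apply: (row_free_inj fF); rewrite KF mul0mx.
Qed.

Lemma pinv_factor m r n (C : 'M[R]_(m, r)) (F : 'M[R]_(r, n)) :
  row_full C -> row_free F ->
  is_pinv (C *m F)
    (F^T *m invmx (F *m F^T) *m (invmx (C^T *m C) *m C^T)).
Proof.
move=> fC fF.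
have uF : F *m F^T \in unitmx by apply: gram_unit.
have uC : C^T *m C \in unitmx.
  have : row_free C^T by rewrite /row_free mxrank_tr.
  by move=> /gram_unit; rewrite trmxK.
set X := _ *m (_ *m C^T).
have eAX : C *m F *m X = C *m invmx (C^T *m C) *m C^T.
  by rewrite /X !mulmxA -(mulmxA C F) mulmxK.
have eXA : X *m (C *m F) = F^T *m invmx (F *m F^T) *m F.
  rewrite /X !mulmxA -(mulmxA _ C^T C) -(mulmxA _ (invmx (C^T *m C))).
  by rewrite mulVmx // mulmx1.
split.
- by rewrite eAX mulmxA -(mulmxA _ C^T C) mulmxKV.
- by rewrite eXA /X !mulmxA -(mulmxA _ F F^T) mulmxKV.
- by rewrite eAX !trmx_mul trmxK trmx_inv trmx_mul trmxK !mulmxA.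
- by rewrite eXA !trmx_mul trmxK trmx_inv trmx_mul trmxK !mulmxA.
Qed.

Lemma pinvP m n (A : 'M[R]_(m, n)) : is_pinv A (pinv A).
Proof.
apply: (@xgetPex _ 0 [set X | is_pinv A X]%classic).
have := pinv_factor (col_base_full A) (row_base_free A).
by rewrite mulmx_base => h; eexists; exact: h.
Qed.

End PseudoInverse.

Record wgraph (R : realType) (n : nat) := WGraph {
  edge : rel 'I_n;
  edge_sym : symmetric edge;
  edge_irr : irreflexive edge;
  weight : 'I_n -> 'I_n -> R;
  weight_sym : forall u v, weight u v = weight v u;
  weight_gt0 : forall u v, edge u v -> 0 < weight u v }.

Section Graph.
Variables (R : realType) (n : nat) (G : wgraph R n).

Definition connected_graph : Prop := forall u v : 'I_n, connect (edge G) u v.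

Definition adj : 'M[R]_n :=
  \matrix_(u, v) if edge G u v then weight G u v else 0.

Definition laplacian : 'M[R]_n := diag_mx (\row_u \sum_v adj u v) - adj.

Definition effres (u v : 'I_n) : R :=
  let x : 'cV[R]_n := delta_mx u ord0 - delta_mx v ord0 in
  (x^T *m pinv laplacian *m x) ord0 ord0.

Definition effres_oracle (u v : nat) : R :=
  if (insub u, insub v) is (Some u', Some v') then effres u' v' else 0.

(* [miss] lists unordered pairs, so both symmetric entries are hidden. *)
Definition known_adj (miss : seq ('I_n * 'I_n)) : 'M[R]_n :=
  \matrix_(u, v) if ((u, v) \in miss) || ((v, u) \in miss) then 0 else adj u v.

End Graph.

(* Computational model: a real RAM, presented as a structured language with
   recursive procedures. Memory consists of integer arrays (indexed by array
   name and position) and real arrays (array name, row, column). The syntax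
   does not mention R: the only real constants are 0 and 1, and a real can
   influence an integer only through the outcome of a comparison. Integer
   arithmetic is limited to addition, truncated subtraction and halving. *)
Inductive iexp :=
| ILit of nat
| IGet of nat & iexp
| IAdd of iexp & iexp
| ISub of iexp & iexp
| IHalf of iexp.

Inductive rexp :=
| RZero
| ROne
| RGet of nat & iexp & iexp
| RAdd of rexp & rexp
| RSub of rexp & rexp
| RMul of rexp & rexp
| RDiv of rexp & rexp.

Inductive bexp :=
| BILt of iexp & iexp
| BRLt of rexp & rexp
| BNot of bexp
| BAnd of bexp & bexp.

(* The rectangle of [brows] x [bcols] cells of array [barr] whose top left
   cell is ([brow0], [bcol0]). *)
Record block := Block {
  barr : nat; brow0 : iexp; bcol0 : iexp; brows : iexp; bcols : iexp }.

Inductive cmd :=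
| Skip
| ISet of nat & iexp & iexp
| RSet of nat & iexp & iexp & rexp
| Query of nat & iexp & iexp & iexp & iexp
| Seq of cmd & cmd
| If of bexp & cmd & cmd
| While of bexp & cmd
| Call of nat & seq iexp & seq block & seq block.

(* A program is a procedure table; execution starts at procedure 0. *)
Definition program := seq cmd.

Section Semantics.
Variable R : realType.

Record state := State {
  imem : nat -> nat -> nat;
  rmem : nat -> nat -> nat -> R }.

Fixpoint ieval (st : state) (e : iexp) : nat :=
  match e with
  | ILit m => m
  | IGet a i => imem st a (ieval st i)
  | IAdd e1 e2 => (ieval st e1 + ieval st e2)%N
  | ISub e1 e2 => (ieval st e1 - ieval st e2)%N
  | IHalf e1 => (ieval st e1)./2
  end.

(* As everywhere in MathComp, x / 0 = 0. *)
Fixpoint reval (st : state) (e : rexp) : R :=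
  match e with
  | RZero => 0
  | ROne => 1
  | RGet a i j => rmem st a (ieval st i) (ieval st j)
  | RAdd e1 e2 => reval st e1 + reval st e2
  | RSub e1 e2 => reval st e1 - reval st e2
  | RMul e1 e2 => reval st e1 * reval st e2
  | RDiv e1 e2 => reval st e1 / reval st e2
  end.

Fixpoint beval (st : state) (b : bexp) : bool :=
  match b with
  | BILt e1 e2 => (ieval st e1 < ieval st e2)%N
  | BRLt e1 e2 => reval st e1 < reval st e2
  | BNot b1 => ~~ beval st b1
  | BAnd b1 b2 => beval st b1 && beval st b2
  end.

Definition iset (st : state) (a i x : nat) : state :=
  State (fun a' i' => if (a' == a) && (i' == i) then x else imem st a' i')
        (rmem st).

Definition rset (st : state) (a i j : nat) (x : R) : state :=
  State (imem st)
        (fun a' i' j' => if [&& a' == a, i' == i & j' == j] then x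
                         else rmem st a' i' j').

Definition block_cells (st : state) (b : block) : nat :=
  (ieval st (brows b) * ieval st (bcols b))%N.

Definition blocks_cells (st : state) (bs : seq block) : nat :=
  sumn [seq block_cells st b | b <- bs].

Definition read_block (st : state) (b : block) (i j : nat) : R :=
  if (i < ieval st (brows b))%N && (j < ieval st (bcols b))%N
  then rmem st (barr b) (ieval st (brow0 b) + i)%N (ieval st (bcol0 b) + j)%N
  else 0.

(* The coordinates of [b] are evaluated in [st]; [m] is the memory updated. *)
Definition write_block (st : state) (b : block) (src : nat -> nat -> R)
    (m : nat -> nat -> nat -> R) : nat -> nat -> nat -> R :=
  let r0 := ieval st (brow0 b) in
  let c0 := ieval st (bcol0 b) in
  fun a i j =>
    if [&& a == barr b, (r0 <= i < r0 + ieval st (brows b))%N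
         & (c0 <= j < c0 + ieval st (bcols b))%N]
    then src (i - r0)%N (j - c0)%N else m a i j.

(* A callee starts in a fresh zero memory, with the integer arguments in
   integer array 0 and the i-th block argument in real array i. *)
Definition call_state (st : state) (ia : seq iexp) (ins : seq block) : state :=
  State (fun a i => if a == 0%N then nth 0%N [seq ieval st e | e <- ia] i
                    else 0%N)
        (fun a i j => nth (fun _ _ => 0) [seq read_block st b | b <- ins] a i j).

(* On return, real array i of the callee is copied to the i-th result block. *)
Definition return_state (st st' : state) (outs : seq block) : state :=
  State (imem st)
        (foldl (fun m ib => write_block st ib.2 (rmem st' ib.1) m)
               (rmem st) (zip (iota 0 (size outs)) outs)).

(* [exec P orc c st st' t q]: with procedure table P and query oracle orc,
   the command c run from st terminates in st' after t steps and q queries.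
   Each assignment, test and query is one step (a program is a fixed finite
   text, so expression sizes are bounded), and a procedure call also pays for
   every argument and every cell passed in either direction. *)
Inductive exec (P : program) (orc : nat -> nat -> R) :
  cmd -> state -> state -> nat -> nat -> Prop :=
| ESkip st : exec P orc Skip st st 1%N 0%N
| EISet st a i e :
    exec P orc (ISet a i e) st (iset st a (ieval st i) (ieval st e)) 1%N 0%N
| ERSet st a i j e :
    exec P orc (RSet a i j e) st
      (rset st a (ieval st i) (ieval st j) (reval st e)) 1%N 0%N
| EQuery st a i j u v :
    exec P orc (Query a i j u v) st
      (rset st a (ieval st i) (ieval st j) (orc (ieval st u) (ieval st v))) 1%N 1%N
| ESeq st st1 st2 c1 c2 t1 t2 q1 q2 :
    exec P orc c1 st st1 t1 q1 -> exec P orc c2 st1 st2 t2 q2 ->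
    exec P orc (Seq c1 c2) st st2 (t1 + t2)%N (q1 + q2)%N
| EIfTrue st st1 b c1 c2 t q :
    beval st b -> exec P orc c1 st st1 t q ->
    exec P orc (If b c1 c2) st st1 t.+1 q
| EIfFalse st st1 b c1 c2 t q :
    ~~ beval st b -> exec P orc c2 st st1 t q ->
    exec P orc (If b c1 c2) st st1 t.+1 q
| EWhileTrue st st1 st2 b c t1 t2 q1 q2 :
    beval st b -> exec P orc c st st1 t1 q1 ->
    exec P orc (While b c) st1 st2 t2 q2 ->
    exec P orc (While b c) st st2 (t1 + t2).+1%N (q1 + q2)%N
| EWhileFalse st b c :
    ~~ beval st b -> exec P orc (While b c) st st 1%N 0%N
| ECall st st1 f ia ins outs t q :
    exec P orc (nth Skip P f) (call_state st ia ins) st1 t q ->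
    exec P orc (Call f ia ins outs) st (return_state st st1 outs)
      (size ia + blocks_cells st ins + blocks_cells st outs + t).+1%N q.

Lemma exec_det P orc c st st1 st2 t1 t2 q1 q2 :
  exec P orc c st st1 t1 q1 -> exec P orc c st st2 t2 q2 ->
  [/\ st1 = st2, t1 = t2 & q1 = q2].
Proof.
move=> H; elim: H st2 t2 q2 => {c st st1 t1 q1}.
- by move=> st st2 t2 q2 H; inversion H.
- by move=> st a i e st2 t2 q2 H; inversion H.
- by move=> st a i j e st2 t2 q2 H; inversion H.
- by move=> st a i j u v st2 t2 q2 H; inversion H.
- move=> st st1 st1' c1 c2 t1 t1' q1 q1' _ IH1 _ IH2 st2 t2 q2 H.
  inversion H as [| | | |? s1 ? ? ? ? ? ? ? E1 E2| | | | |]; subst.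
  have [e1 e2 e3] := IH1 _ _ _ E1; subst.
  by have [-> -> ->] := IH2 _ _ _ E2.
- move=> st st1 b c1 c2 t q hb _ IH st2 t2 q2 H.
  inversion H as [| | | | |? ? ? ? ? ? ? hb' E|? ? ? ? ? ? ? hb' E| | |]; subst.
    by have [-> -> ->] := IH _ _ _ E.
  by rewrite hb in hb'.
- move=> st st1 b c1 c2 t q hb _ IH st2 t2 q2 H.
  inversion H as [| | | | |? ? ? ? ? ? ? hb' E|? ? ? ? ? ? ? hb' E| | |]; subst.
    by rewrite hb' in hb.
  by have [-> -> ->] := IH _ _ _ E.
- move=> st st1 st1' b c t1 t1' q1 q1' hb _ IH1 _ IH2 st2 t2 q2 H.
  inversion H as [| | | | | | |? ? ? ? ? ? ? ? ? hb' E1 E2|? ? ? hb'|]; subst.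
    have [e1 e2 e3] := IH1 _ _ _ E1; subst.
    by have [-> -> ->] := IH2 _ _ _ E2.
  by rewrite hb in hb'.
- move=> st b c hb st2 t2 q2 H.
  inversion H as [| | | | | | |? ? ? ? ? ? ? ? ? hb' E1 E2|? ? ? hb'|]; subst.
    by rewrite hb' in hb.
  by [].
- move=> st st1 f ia ins outs t q _ IH st2 t2 q2 H.
  inversion H as [| | | | | | | | |? ? ? ? ? ? ? ? E]; subst.
  by have [-> -> ->] := IH _ _ _ E.
Qed.

Definition run (P : program) (orc : nat -> nat -> R) (st st' : state)
    (t q : nat) : Prop :=
  exec P orc (nth Skip P 0%N) st st' t q.

Definition mx_array n (A : 'M[R]_n) (i j : nat) : R :=
  if (insub i, insub j) is (Some i', Some j') then A i' j' else 0.

Definition matmul_input n (A B : 'M[R]_n) : state :=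
  State (fun a i => if (a == 0%N) && (i == 0%N) then n else 0%N)
        (fun a => match a with
                  | 0%N => mx_array A
                  | 1%N => mx_array B
                  | _ => fun _ _ => 0
                  end).

(* Some program multiplies n x n matrices in O(n^omega) steps, leaving the
   product in real array 2. It makes no query, so orc is irrelevant. *)
Definition matmul_exponent (omega : R) : Prop :=
  exists (Q : program) (C : R),
    forall (orc : nat -> nat -> R) (n : nat) (A B : 'M[R]_n), (0 < n)%N ->
    exists (st : state) (t : nat),
      [/\ run Q orc (matmul_input A B) st t 0%N,
          forall i j : 'I_n, rmem st 2%N i j = (A *m B) i j
        & t%:R <= C * n%:R `^ omega].

(* Integer array 0 holds n, s, k; integer arrays 1 and 2 hold the endpoints of
   the k pairs; real array 0 holds the known entries of the adjacency matrix
   (0 at the missing ones); column 0 of real array 1 holds the s weights. *)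
Definition reconstruction_input n (G : wgraph R n) (W : seq R)
    (miss : seq ('I_n * 'I_n)) : state :=
  State (fun a i => match a with
                    | 0 => nth 0 [:: n; size W; size miss] i
                    | 1 => nth 0 [seq val e.1 | e <- miss] i
                    | 2 => nth 0 [seq val e.2 | e <- miss] i
                    | _ => 0
                    end)%N
        (fun a => match a with
                  | 0%N => mx_array (known_adj G miss)
                  | 1%N => fun i j => if j == 0%N then nth 0 W i else 0
                  | _ => fun _ _ => 0
                  end).

End Semantics.

(* Main.v *)
Require Import Defs.
From mathcomp Require Import all_boot all_order all_algebra.
From mathcomp Require Import boolp classical_sets reals exp.
From mathcomp Require Import ring lra zify.
Set Implicit Arguments.
Unset Strict Implicit.
Unset Printing Implicit Defensive.
Import Order.TTheory GRing.Theory Num.Theory.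
Local Open Scope ring_scope.

(** Query the [k] missing pairs, then try all [s ^ k] assignments of weights to
    them. For a candidate with nonnegative weights and Laplacian [L], put
    [M = L + J] with [J] the all-ones matrix. When [M] is invertible, the
    effective resistance of [u, v] is [b^T M^-1 b] with [b = 1_u - 1_v].

    At most one candidate fits the measurements: if [M1] and [M2] agree outside
    the missing pairs and give the same resistances on them, then
    [D = M2 - M1] satisfies [tr (D M1^-1 D M2^-1) = tr (D (M1^-1 - M2^-1)) = 0],
    and the left side is the squared norm of a congruent copy of [D].

    A candidate costs [O(n^omega)]: [M] is inverted by recursion on the Schur
    complement of its upper left half, and the result is checked by one more
    multiplication because candidates may be disconnected, hence singular. The
    recursion is dominated by its top level because [omega >= 2]: a step changes
    at most one cell per unit of time, and a product has [n^2] nonzero cells. *)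

(** * The Laplacian plus the all-ones matrix *)

(** The Laplacian [L] kills the constants, on which [J] acts as [n], while [J] kills the vectors of
    sum zero. Hence for a connected graph [(L + J)^-1] and the pseudoinverse agree on every [b], and
    for a candidate the invertibility of [M] takes the place of connectedness. Correctness then
    splits in two. A zero residual certifies that a candidate has an invertible [M] and fits the
    measurements, whatever the recursion did on the way, and uniqueness identifies it. The recursion
    itself has to be right only for the true weights, where connectedness makes [M] positive
    definite, so that leading blocks and Schur complements are invertible and no pivoting occurs.
    The sign of the weights is tested separately: [W] may contain negative reals, and uniqueness
    rests on both quadratic forms being semidefinite. *)

Section LaplacianPlusOnes.
Variables (R : realType) (n : nat).
Implicit Types (A B M X Y : 'M[R]_n) (x y : 'cV[R]_n).

Definition lapJ A : 'M[R]_n :=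
  diag_mx (\row_u \sum_v A u v) - A + const_mx 1.

Definition qform M x : R := (x^T *m M *m x) ord0 ord0.

Definition pair_res X (u v : 'I_n) : R := X u u + X v v - X u v - X v u.

Definition edge_vec (u v : 'I_n) : 'cV[R]_n := delta_mx u ord0 - delta_mx v ord0.

Lemma qformE M x : qform M x = \sum_u \sum_v x u ord0 * M u v * x v ord0.
Proof.
rewrite /qform mxE exchange_big; apply: eq_bigr => v _.
rewrite mxE big_distrl; apply: eq_bigr => u _; by rewrite !mxE.
Qed.

Lemma lapJE A u v :
  lapJ A u v = (if u == v then \sum_w A u w else 0) - A u v + 1.
Proof. by rewrite !mxE mulrb. Qed.

Lemma sum_if_eq (u : 'I_n) (a : R) (F : 'I_n -> R) :
  \sum_v (if u == v then a else 0) * F v = a * F u.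
Proof.
rewrite (bigD1 u) //= eqxx big1 ?addr0 // => v.
by rewrite eq_sym => /negPf ->; rewrite mul0r.
Qed.

Lemma lapJ_mulE A x u :
  (lapJ A *m x) u ord0 =
  \sum_v A u v * (x u ord0 - x v ord0) + \sum_v x v ord0.
Proof.
rewrite mxE.
under eq_bigr => v _ do rewrite lapJE !mulrDl mul1r mulNr.
rewrite !big_split /= sum_if_eq; congr (_ + _).
rewrite sumrN mulr_suml -sumrB; apply: eq_bigr => v _; ring.
Qed.

Lemma lapJ_tr A : A^T = A -> (lapJ A)^T = lapJ A.
Proof. by move=> sA; rewrite /lapJ !linearD /= linearN /= tr_diag_mx sA trmx_const. Qed.

(** The Laplacian is half the sum over ordered pairs of [A u v] times [b b^T], with [b] the edge
    vector, and the trace of [b b^T Y] is [pair_res Y u v]. Taking [Y = x x^T] gives the Dirichlet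
    form in [qform_lapJ]. *)
Lemma mxtrace_lapJ A Y : A^T = A ->
  \tr (lapJ A *m Y) =
  2^-1 * (\sum_u \sum_v A u v * pair_res Y u v) + \sum_u \sum_v Y u v.
Proof.
move=> sA.
have Asym u v : A u v = A v u by rewrite -{1}sA mxE.
have -> : \tr (lapJ A *m Y) =
    \sum_u (\sum_v A u v * (Y u u - Y v u)) + \sum_u \sum_v Y v u.
  rewrite /mxtrace -big_split; apply: eq_bigr => u _.
  transitivity ((lapJ A *m col u Y) u ord0).
    by rewrite colE mulmxA -colE [RHS]mxE.
  rewrite lapJ_mulE; congr (_ + _); apply: eq_bigr => v _; by rewrite !mxE.
congr (_ + _); last by rewrite exchange_big.
set S := \sum_u _.
have S2 : S = \sum_u \sum_v A u v * (Y v v - Y u v).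
  rewrite /S exchange_big /=; apply: eq_bigr => u _; apply: eq_bigr => v _.
  by rewrite Asym.
have -> : S = 2^-1 * (S + S) by field.
congr (_ * _); rewrite {2}S2 /S -big_split; apply: eq_bigr => u _.
rewrite -big_split; apply: eq_bigr => v _ /=; rewrite /pair_res; ring.
Qed.

Lemma qform_edge_vec M u v : qform M (edge_vec u v) = pair_res M u v.
Proof.
rewrite /qform /edge_vec mulmxBr linearB /= !trmx_delta !mulmxBl.
rewrite -!rowE -!colE !mxE /pair_res; ring.
Qed.

Lemma qform_outer M x : qform M x = \tr (M *m (x *m x^T)).
Proof. by rewrite mulmxA mxtrace_mulC mulmxA /qform trace_mx11. Qed.

Lemma qform_lapJ A x : A^T = A ->
  qform (lapJ A) x =
  2^-1 * (\sum_u \sum_v A u v * (x u ord0 - x v ord0) ^+ 2)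
    + (\sum_u x u ord0) ^+ 2.
Proof.
move=> sA; rewrite qform_outer mxtrace_lapJ //; congr (_ * _ + _).
  apply: eq_bigr => u _; apply: eq_bigr => v _; congr (_ * _).
  rewrite /pair_res !mxE !big_ord1 !mxE; ring.
rewrite expr2 mulr_suml; apply: eq_bigr => u _.
by rewrite mulr_sumr; apply: eq_bigr => v _; rewrite mxE big_ord1 mxE.
Qed.

Section Nonneg.
Variable A : 'M[R]_n.
Hypotheses (sA : A^T = A) (A0 : forall u v, 0 <= A u v).

Lemma qform_lapJ_ge0 x : 0 <= qform (lapJ A) x.
Proof.
rewrite qform_lapJ //; apply: addr_ge0; last exact: sqr_ge0.
apply: mulr_ge0; first by rewrite invr_ge0.
by apply: sumr_ge0 => u _; apply: sumr_ge0 => v _; rewrite mulr_ge0 ?sqr_ge0.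
Qed.

Lemma qform_lapJ_eq0 x : qform (lapJ A) x = 0 ->
  (forall u v, A u v * (x u ord0 - x v ord0) ^+ 2 = 0) /\ \sum_u x u ord0 = 0.
Proof.
rewrite qform_lapJ // => /eqP.
have h u v : 0 <= A u v * (x u ord0 - x v ord0) ^+ 2 by rewrite mulr_ge0 ?sqr_ge0.
have h' u : 0 <= \sum_v A u v * (x u ord0 - x v ord0) ^+ 2 by apply: sumr_ge0.
rewrite paddr_eq0 ?sqr_ge0 ?mulr_ge0 ?sumr_ge0 ?invr_ge0 //.
rewrite mulf_eq0 invr_eq0 pnatr_eq0 /= sqrf_eq0 => /andP[].
rewrite psumr_eq0 // => /allP S /eqP ->; split=> // u v.
have := S u (mem_index_enum u); rewrite psumr_eq0 //= => /allP /(_ v).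
by rewrite mem_index_enum => /(_ isT) /eqP.
Qed.

(** Combined with [qform_lapJ_eq0], a vector on which the form vanishes lies in the kernel. This
    replaces the square root of a semidefinite matrix. *)
Lemma lapJ_ker x : (forall u v, A u v * (x u ord0 - x v ord0) ^+ 2 = 0) ->
  \sum_u x u ord0 = 0 -> lapJ A *m x = 0.
Proof.
move=> h s; apply/colP => u; rewrite lapJ_mulE s addr0 mxE big1 // => v _.
have /eqP := h u v; rewrite mulf_eq0 sqrf_eq0 => /orP[] /eqP ->;
by rewrite ?mul0r ?mulr0.
Qed.

End Nonneg.

(** With the sign built in, the Schur complement and all blocks of the inverse are sums of products,
    so a single procedure computing [X + Y Z] serves for the whole recursion. *)
Definition neg_inverse M X : Prop := M *m X = - 1%:M.

Lemma neg_inverseC M X : neg_inverse M X -> neg_inverse X M.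
Proof.
rewrite /neg_inverse => h.
have : M *m - X = 1%:M by rewrite mulmxN h opprK.
by move/mulmx1C; rewrite mulNmx => <-; rewrite opprK.
Qed.

Lemma neg_inverse_tr M X : M^T = M -> neg_inverse M X -> X^T = X.
Proof.
move=> sM h.
have h2 : X^T *m M = - 1%:M by rewrite -{1}sM -trmx_mul h linearN /= trmx1.
have : X^T *m M *m X = X^T *m (M *m X) by rewrite mulmxA.
rewrite h2 (h : M *m X = _) mulNmx mulmxN mul1mx mulmx1.
by move/oppr_inj.
Qed.

(** Transfers semidefiniteness from [M] to [- X]. *)
Lemma qform_neg_inverse M X z : neg_inverse M X -> X^T = X ->
  qform X z = - qform M (X *m z).
Proof.
move=> h sX; rewrite /qform trmx_mul sX.
have -> : z^T *m X *m M *m (X *m z) = z^T *m X *m (M *m X) *m z.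
  by rewrite !mulmxA.
by rewrite (h : M *m X = _) mulmxN mulmx1 mulNmx [in RHS]mxE opprK.
Qed.

(** Multiplying [M y = b] by the all-ones row shows that [y] has sum zero as soon as [b] has. *)
Lemma lapJ_const A : A^T = A ->
  (const_mx 1 : 'rV[R]_n) *m lapJ A = n%:R *: const_mx 1.
Proof.
move=> sA; apply: trmx_inj; rewrite trmx_mul lapJ_tr // linearZ /= !trmx_const.
apply/colP => u; rewrite lapJ_mulE big1 ?add0r => [|v _]; last first.
  by rewrite !mxE subrr mulr0.
by under eq_bigr => v _ do rewrite mxE; rewrite sumr_const card_ord !mxE mulr1.
Qed.

(* The trace of [D X1 D X2], with [D] the difference of the two Laplacians, is
   a weighted sum of squares whose vanishing forces [D = 0]. *)
Lemma lapJ_pair_res_inj A1 A2 X1 X2 :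
  A1^T = A1 -> A2^T = A2 ->
  (forall u v, 0 <= A1 u v) -> (forall u v, 0 <= A2 u v) ->
  neg_inverse (lapJ A1) X1 -> neg_inverse (lapJ A2) X2 ->
  (forall u v, A1 u v = A2 u v \/ pair_res X1 u v = pair_res X2 u v) ->
  lapJ A1 = lapJ A2.
Proof.
move=> s1 s2 p1 p2 i1 i2 hR.
have sX1 := neg_inverse_tr (lapJ_tr s1) i1.
have sX2 := neg_inverse_tr (lapJ_tr s2) i2.
set D := lapJ A2 - lapJ A1.
have sD : D^T = D by rewrite /D linearB /= !lapJ_tr.
have trD Y : \tr (D *m Y) =
    2^-1 * (\sum_u \sum_v (A2 u v - A1 u v) * pair_res Y u v).
  rewrite /D mulmxBl linearB /= !mxtrace_lapJ // opprD addrACA subrr addr0.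
  rewrite -mulrBr; congr (_ * _); rewrite -sumrB; apply: eq_bigr => u _.
  by rewrite -sumrB; apply: eq_bigr => v _; rewrite mulrBl.
have eX : X1 *m D *m X2 = X2 - X1.
  rewrite /D mulmxBr mulmxBl -mulmxA (i2 : _ *m X2 = _) mulmxN mulmx1.
  by rewrite (neg_inverseC i1 : X1 *m _ = _) mulNmx mul1mx opprK addrC.
have t0 : \tr (D *m (X1 *m D *m X2)) = 0.
  rewrite eX trD big1 ?mulr0 // => u _; rewrite big1 // => v _.
  have : pair_res (X2 - X1) u v = pair_res X2 u v - pair_res X1 u v.
    rewrite /pair_res !mxE; ring.
  move=> ->; case: (hR u v) => ->; by rewrite subrr ?mul0r ?mulr0.
(* [B] is semidefinite because [- X1] is. Instead of a square root of [lapJ A2], the trace of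
   [lapJ A2 *m B] is expanded by [mxtrace_lapJ]: its terms are nonnegative values of the form of [B]
   at edge vectors and at the all-ones vector, so each of them vanishes. *)
set B := - (X2 *m D *m X1 *m D *m X2).
have qB z : qform B z = qform (lapJ A1) (X1 *m (D *m X2 *m z)).
  apply: oppr_inj; rewrite -qform_neg_inverse //.
  rewrite /qform /B !trmx_mul sX2 sD mulmxN mulNmx mxE opprK.
  by rewrite !mulmxA.
have trB : \tr (lapJ A2 *m B) = 0.
  rewrite /B mulmxN !mulmxA (i2 : _ *m X2 = _) !mulNmx opprK mul1mx.
  by rewrite -!mulmxA !mulmxA -!mulmxA in t0 *.
have Bge z : 0 <= qform B z by rewrite qB qform_lapJ_ge0.
have B0 z : qform B z = 0 -> D *m X2 *m z = 0.
  rewrite qB => /(qform_lapJ_eq0 s1 p1) [h s].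
  have := lapJ_ker h s; rewrite mulmxA (i1 : _ *m X1 = _) mulNmx mul1mx.
  by move/eqP; rewrite oppr_eq0 => /eqP.
have sumB : \sum_u \sum_v B u v = qform B (const_mx 1).
  rewrite qformE; apply: eq_bigr => u _; apply: eq_bigr => v _.
  by rewrite !mxE mul1r mulr1.
move: trB; rewrite mxtrace_lapJ // sumB => /eqP.
have h u v : 0 <= A2 u v * pair_res B u v.
  by rewrite -qform_edge_vec mulr_ge0.
rewrite paddr_eq0 //; last first.
  by rewrite mulr_ge0 ?invr_ge0 // sumr_ge0 // => u _; apply: sumr_ge0.
rewrite mulf_eq0 invr_eq0 pnatr_eq0 /= psumr_eq0 => [|u _]; last exact: sumr_ge0.
case/andP=> /allP S /eqP /B0 DX1.
have Suv u v : A2 u v = 0 \/ D *m X2 *m edge_vec u v = 0.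
  have := S u (mem_index_enum u); rewrite psumr_eq0 //= => /allP /(_ v).
  rewrite mem_index_enum => /(_ isT); rewrite mulf_eq0 => /orP[/eqP|/eqP]; first by left.
  by rewrite -qform_edge_vec => /B0; right.
(* Each row of [D *m X2] has sum zero and is constant along the pairs where [A2] is nonzero, hence
   lies in the kernel of [lapJ A2]. *)
have DXM : D *m X2 *m lapJ A2 = 0.
  apply: trmx_inj; rewrite trmx_mul lapJ_tr // trmx0.
  apply/matrixP => i j.
  transitivity ((lapJ A2 *m (row j (D *m X2))^T) i ord0).
    by rewrite tr_row colE mulmxA -colE [RHS]mxE.
  rewrite (lapJ_ker (A := A2)) ?mxE //.
    move=> u v; case: (Suv u v) => [-> | e]; first by rewrite mul0r.
    have /eqP := congr1 (fun M : 'cV_n => M j ord0) e.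
    rewrite /edge_vec mulmxBr -!colE !mxE subr_eq0 => /eqP e'.
    by rewrite e' subrr expr0n mulr0.
  have := congr1 (fun M : 'cV_n => M j ord0) DX1.
  rewrite /= mxE [X in _ = X -> _]mxE => e; rewrite -[RHS]e; apply: eq_bigr => u _.
  by rewrite !mxE mulr1.
have : D = 0.
  move: DXM; rewrite -mulmxA (neg_inverseC i2 : X2 *m _ = _) mulmxN mulmx1.
  by move/eqP; rewrite oppr_eq0 => /eqP.
by move/eqP; rewrite subr_eq0 => /eqP ->.
Qed.

Lemma lapJ_offdiag A1 A2 (u v : 'I_n) :
  lapJ A1 = lapJ A2 -> u != v -> A1 u v = A2 u v.
Proof.
move=> e /negPf ne; have := congr1 (fun M : 'M_n => M u v) e.
by rewrite /= !lapJE ne !sub0r => /addIr /oppr_inj.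
Qed.

End LaplacianPlusOnes.

(** * Effective resistance through the inverse of [L + J] *)

Section GraphResistance.
Variables (R : realType) (n : nat) (G : wgraph R n).

Lemma adj_tr : (adj G)^T = adj G.
Proof. by apply/matrixP => u v; rewrite !mxE edge_sym weight_sym. Qed.

Lemma adj_ge0 u v : 0 <= adj G u v.
Proof. by rewrite mxE; case: ifP => // /weight_gt0 /ltW. Qed.

Lemma lapJ_adj : lapJ (adj G) = laplacian G + const_mx 1.
Proof. by []. Qed.

(** A condition on the quadratic form alone, inherited by leading blocks and Schur complements, so
    that the recursion carries no symmetry along. *)
Definition posdef m (M : 'M[R]_m) : Prop :=
  forall x : 'cV[R]_m, x != 0 -> 0 < qform M x.

(** A vector with vanishing form is constant along edges, hence constant by connectedness, and its
    sum is zero. *)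
Lemma posdef_lapJ_adj : connected_graph G -> posdef (lapJ (adj G)).
Proof.
move=> cG x; rewrite lt_neqAle (qform_lapJ_ge0 adj_tr adj_ge0) andbT.
apply: contraNN => /eqP /esym /(qform_lapJ_eq0 adj_tr adj_ge0) [h s].
have hE u v : edge G u v -> x u ord0 = x v ord0.
  move=> e; have /eqP := h u v; rewrite mulf_eq0 sqrf_eq0 subr_eq0 => /orP[|/eqP//].
  by rewrite mxE e => /eqP E; have := weight_gt0 e; rewrite E ltxx.
have hC u v : x u ord0 = x v ord0.
  have /connectP[p + ->] := cG u v.
  elim: p u => //= w p IH u /andP[/hE -> ]; exact: IH.
apply/eqP/colP => u; rewrite mxE; move: s.
rewrite (eq_bigr (fun _ => x u ord0)) => [|v _]; last exact: hC.
rewrite sumr_const card_ord => /eqP; rewrite mulrn_eq0 => /orP[/eqP n0|/eqP //].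
by have := ltn_ord u; rewrite {2}n0 ltn0.
Qed.

(** The solution [y] of [M y = b] has sum zero, so [J] drops out and [L y = b]. Then
    [b^T L^+ b = y^T L L^+ L y = y^T L y] by the first Penrose condition, whichever solution [y]
    is. *)
Lemma effres_neg_inverse X u v : neg_inverse (lapJ (adj G)) X ->
  effres G u v = - pair_res X u v.
Proof.
move=> i; have sX := neg_inverse_tr (lapJ_tr adj_tr) i.
set J : 'M[R]_n := const_mx 1.
set b := edge_vec R u v; set y := - (X *m b).
have My : lapJ (adj G) *m y = b by rewrite mulmxN mulmxA i mulNmx mul1mx opprK.
have o_b : (const_mx 1 : 'rV[R]_n) *m b = 0.
  by apply/matrixP => k l; rewrite mulmxBr -!colE !mxE subrr.
have Jy : J *m y = 0.
  have : (const_mx 1 : 'rV[R]_n) *m y = 0.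
    move: o_b; rewrite -My mulmxA (lapJ_const adj_tr) -scalemxAl => /eqP.
    rewrite scaler_eq0 pnatr_eq0 => /orP[/eqP n0|/eqP//].
    by have := ltn_ord u; rewrite {2}n0 ltn0.
  move=> e; apply/matrixP => k l.
  have := congr1 (fun M : 'rV_1 => M ord0 l) e; rewrite !mxE => E.
  by rewrite -[RHS]E; apply: eq_bigr => w _; rewrite !mxE.
have Ly : laplacian G *m y = b by rewrite -My lapJ_adj (mulmxDl (laplacian G)) Jy addr0.
have sL : (laplacian G)^T = laplacian G.
  by rewrite /laplacian linearB /= tr_diag_mx adj_tr.
have [e1 _ _ _] := pinvP (laplacian G).
have -> : effres G u v = (y^T *m laplacian G *m y) ord0 ord0.
  rewrite /effres -/(edge_vec R u v) -/b -Ly trmx_mul sL.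
  have -> : y^T *m laplacian G *m pinv (laplacian G) *m (laplacian G *m y) =
     y^T *m (laplacian G *m pinv (laplacian G) *m laplacian G) *m y.
    by rewrite !mulmxA.
  by rewrite e1.
rewrite -mulmxA Ly /y linearN /= trmx_mul sX mulNmx mxE.
by rewrite -qform_edge_vec.
Qed.

End GraphResistance.

(** * Inversion by Schur complement *)

Section BlockNegInverse.
Variable R : realType.

Section TwoByTwo.
Variables (p q : nat).
Variables (A : 'M[R]_p) (B : 'M[R]_(p, q)) (C : 'M[R]_(q, p)) (D : 'M[R]_q).

Lemma posdef_block_ul : posdef (block_mx A B C D) -> posdef A.
Proof.
move=> pd x x0; have := pd (col_mx x 0); rewrite /qform tr_col_mx.
rewrite mul_row_block mul_row_col trmx0 !mul0mx !addr0 !mulmx0 addr0; apply.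
by apply: contraNneq x0 => /eqP; rewrite col_mx_eq0 => /andP[].
Qed.

Variables (N : 'M[R]_p) (T : 'M[R]_q).
Hypothesis AN : neg_inverse A N.

(** Completing [y] by the upper half [N B y] makes the upper half of the product vanish; what
    remains of the form is that of the Schur complement at [y]. *)
Lemma posdef_schur :
  posdef (block_mx A B C D) -> posdef (D + C *m (N *m B)).
Proof.
move=> pd y y0; have := pd (col_mx (N *m B *m y) y).
have e : block_mx A B C D *m col_mx (N *m B *m y) y =
    col_mx 0 ((D + C *m (N *m B)) *m y).
  rewrite mul_block_col !mulmxA (AN : A *m N = _) !mulNmx mul1mx addNr.
  by rewrite mulmxDl (addrC (D *m y)).
rewrite /qform tr_col_mx -(mulmxA (row_mx _ _)) e mul_row_col mulmx0 add0r.
rewrite (mulmxA y^T); apply.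
by apply: contraNneq y0 => /eqP; rewrite col_mx_eq0 => /andP[_ /eqP ->].
Qed.

Lemma neg_inverse_block : neg_inverse (D + C *m (N *m B)) T ->
  let F := N *m B in let E := C *m N in
  neg_inverse (block_mx A B C D)
    (block_mx (N + F *m T *m E) (F *m T) (T *m E) T).
Proof.
move=> ST F E.
have AF : A *m F = - B by rewrite /F mulmxA (AN : A *m N = _) mulNmx mul1mx.
have CF : C *m F *m T = - 1%:M - D *m T.
  by rewrite -(ST : _ *m T = _) mulmxDl addrC addKr.
have CN : C *m N = E by [].
move: AF CF CN; clearbody F E => AF CF CN.
rewrite /neg_inverse mulmx_block !mulmxDr !mulmxA AF CF (AN : A *m N = _) CN.
have -> : - 1%:M + - B *m T *m E + B *m T *m E = - 1%:M by rewrite !mulNmx subrK.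
have -> : - B *m T + B *m T = 0 by rewrite mulNmx addNr.
have -> : E + (- 1%:M - D *m T) *m E + D *m T *m E = 0.
  by rewrite mulmxBl mulNmx mul1mx addrA subrr sub0r addNr.
by rewrite subrK (scalar_mx_block p q 1) opp_block_mx !oppr0.
Qed.

End TwoByTwo.

Lemma neg_inverse1 (M : 'M[R]_1) (x : R) :
  posdef M -> x = - (M ord0 ord0)^-1 -> neg_inverse M x%:M.
Proof.
move=> pd ->; apply/matrixP => i j; rewrite !ord1 mul_mx_scalar !mxE /=.
rewrite mulNr mulVf // gt_eqF //.
have /pd : (1%:M : 'cV[R]_1) != 0.
  by apply/eqP => /matrixP /(_ ord0 ord0) /eqP; rewrite !mxE oner_eq0.
by rewrite qformE !big_ord1 !mxE mul1r mulr1.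
Qed.

End BlockNegInverse.

(** * Execution with a time bound *)

(** Relocation: calls refer to absolute positions in the procedure table, and the multiplication
    program, which is arbitrary, gets appended after other procedures. *)
Fixpoint shift_cmd (d : nat) (c : cmd) : cmd :=
  match c with
  | Seq c1 c2 => Seq (shift_cmd d c1) (shift_cmd d c2)
  | If b c1 c2 => If b (shift_cmd d c1) (shift_cmd d c2)
  | While b c1 => While b (shift_cmd d c1)
  | Call f ia ins outs => Call (d + f) ia ins outs
  | c => c
  end.

Definition link (pre Q : program) : program :=
  pre ++ map (shift_cmd (size pre)) Q.

Lemma nth_link pre Q f :
  nth Skip (link pre Q) (size pre + f) = shift_cmd (size pre) (nth Skip Q f).
Proof.
rewrite nth_cat ltnNge leq_addr /= addKn.
case: (ltnP f (size Q)) => h; first by rewrite (nth_map Skip).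
(* Past the end of [Q] both sides are [Skip], which relocation fixes. *)
by rewrite !nth_default ?size_map.
Qed.

Section Runs.
Variables (R : realType) (P : program) (orc : nat -> nat -> R).
Implicit Types (st : state R) (c : cmd) (T : R) (q : nat).

Lemma exec_link pre Q c st st' t q :
  exec Q orc c st st' t q ->
  exec (link pre Q) orc (shift_cmd (size pre) c) st st' t q.
Proof.
elim=> {c st st' t q} /=; try by econstructor; eauto.
by move=> st st1 f ia ins outs t q _ IH; constructor; rewrite nth_link.
Qed.

(** A total-correctness triple: the time is bounded by a real number, so that powers with exponent
    [omega] can be used directly, whereas the number of queries is exact. *)
Definition runs c st T q (Post : state R -> Prop) : Prop :=
  exists st' t, [/\ exec P orc c st st' t q, t%:R <= T & Post st'].

Lemma runs_conseq c st T T' q q' (Post Post' : state R -> Prop) :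
  runs c st T q Post -> T <= T' -> q = q' ->
  (forall st', Post st' -> Post' st') -> runs c st T' q' Post'.
Proof.
move=> [st' [t [h1 h2 h3]]] hT <- hP; exists st', t; split=> //; last exact: hP.
exact: le_trans hT.
Qed.

Lemma runs_iset st a i e (Post : state R -> Prop) :
  Post (iset st a (ieval st i) (ieval st e)) -> runs (ISet a i e) st 1 0 Post.
Proof. by eexists; eexists; split; [exact: EISet| |]. Qed.

Lemma runs_rset st a i j e (Post : state R -> Prop) :
  Post (rset st a (ieval st i) (ieval st j) (reval st e)) ->
  runs (RSet a i j e) st 1 0 Post.
Proof. by eexists; eexists; split; [exact: ERSet| |]. Qed.

Lemma runs_query st a i j u v (Post : state R -> Prop) :
  Post (rset st a (ieval st i) (ieval st j) (orc (ieval st u) (ieval st v))) ->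
  runs (Query a i j u v) st 1 1 Post.
Proof. by eexists; eexists; split; [exact: EQuery| |]. Qed.

Lemma runs_seq c1 c2 st T1 T2 q1 q2 (Post : state R -> Prop) :
  runs c1 st T1 q1 (fun st1 => runs c2 st1 T2 q2 Post) ->
  runs (Seq c1 c2) st (T1 + T2) (q1 + q2) Post.
Proof.
move=> [st1 [t1 [h1 b1 [st2 [t2 [h2 b2 hP]]]]]].
by exists st2, (t1 + t2)%N; split; [exact: ESeq h1 h2|rewrite natrD lerD|].
Qed.

Lemma runs_if b c1 c2 st T q (Post : state R -> Prop) :
  (beval st b -> runs c1 st T q Post) -> (~~ beval st b -> runs c2 st T q Post) ->
  runs (If b c1 c2) st (T + 1) q Post.
Proof.
move=> h1 h2; case hb : (beval st b).
  have [st' [t [e l p]]] := h1 hb; exists st', t.+1; split=> //.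
    exact: EIfTrue e.
  by rewrite -natr1 lerD2r.
have [st' [t [e l p]]] := h2 (negbT hb); exists st', t.+1; split=> //.
  exact: EIfFalse (negbT hb) e.
by rewrite -natr1 lerD2r.
Qed.

(** Even [Skip] is charged one step. *)
Lemma runs_skip st (Post : state R -> Prop) : Post st -> runs Skip st 1 0 Post.
Proof. by move=> h; exists st, 1%N; split=> //; exact: ESkip. Qed.

(** [N] only bounds the number of rounds: the invariant must exclude a true guard from round [N] on,
    and the loop may stop earlier. *)
Lemma runs_while b c st T (N : nat) (Inv : nat -> state R -> Prop) :
  0 <= T ->
  (forall j st', Inv j st' -> beval st' b ->
     (j < N)%N /\ runs c st' T 0 (Inv j.+1)) ->
  Inv 0%N st ->
  runs (While b c) st (N%:R * (T + 1) + 1) 0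
    (fun st' => ~~ beval st' b /\ exists j, Inv j st').
Proof.
move=> T0 step.
suff H m : forall j st', (N - j <= m)%N -> Inv j st' ->
    runs (While b c) st' (m%:R * (T + 1) + 1) 0
      (fun st' => ~~ beval st' b /\ exists j, Inv j st').
  by move=> h; apply: (H N 0%N) => //; rewrite subn0.
elim: m => [|m IH] j st' hm hI; case hb : (beval st' b).
- have [hj _] := step _ _ hI hb; lia.
- exists st', 1%N; split; [by apply: EWhileFalse; rewrite hb|lra|].
  by split; [rewrite hb|exists j].
- have [hj [st1 [t1 [e1 l1 p1]]]] := step _ _ hI hb.
  have hm' : (N - j.+1 <= m)%N by lia.
  have [st2 [t2 [e2 l2 p2]]] := IH _ _ hm' p1.
  exists st2, (t1 + t2).+1; split=> //.
    exact: EWhileTrue hb e1 e2.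
  rewrite -(natr1 (t1 + t2)%N) -(natr1 m) natrD; lra.
- exists st', 1%N; split; [by apply: EWhileFalse; rewrite hb| |].
    by rewrite lerDr; apply: mulr_ge0 => //; lra.
  by split; [rewrite hb|exists j].
Qed.

Lemma runs_call f ia ins outs st T q (Post : state R -> Prop) :
  runs (nth Skip P f) (call_state st ia ins) T q
    (fun st1 => Post (return_state st st1 outs)) ->
  runs (Call f ia ins outs) st
    ((size ia + blocks_cells st ins + blocks_cells st outs).+1%:R + T) q Post.
Proof.
move=> [st1 [t [e l p]]]; eexists; eexists; split; [exact: ECall e| |exact: p].
by rewrite -addSn natrD lerD2l.
Qed.

Definition For (a : nat) (bound : iexp) (body : cmd) : cmd :=
  Seq (ISet a (ILit 0) (ILit 0))
    (While (BILt (IGet a (ILit 0)) bound)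
      (Seq body (ISet a (ILit 0) (IAdd (IGet a (ILit 0)) (ILit 1))))).

(** Each round pays two more steps, for test and increment; the final 2 is the initialization and
    the failing test. The invariant pins the counter, and the body is judged after the increment. *)
Lemma runs_for a bound body st T q (N : nat) (Inv : nat -> state R -> Prop) :
  (forall i st', Inv i st' -> imem st' a 0%N = i /\ ieval st' bound = N) ->
  (forall i st', Inv i st' -> (i < N)%N -> runs body st' T q
     (fun st1 => Inv i.+1 (iset st1 a 0 (imem st1 a 0%N + 1)%N))) ->
  Inv 0%N (iset st a 0 0) ->
  runs (For a bound body) st (N%:R * (T + 2) + 2) (N * q) (Inv N).
Proof.
move=> hI step h0.
suff H m : forall i st', (m + i = N)%N -> Inv i st' ->
    runs (While (BILt (IGet a (ILit 0)) bound)
      (Seq body (ISet a (ILit 0) (IAdd (IGet a (ILit 0)) (ILit 1)))))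
      st' (m%:R * (T + 2) + 1) (m * q) (Inv N).
  apply: (runs_conseq (T := 1 + (N%:R * (T + 2) + 1)) (q := 0 + N * q)%N);
    [|by lra|by []|by move=> ? h; exact: h].
  apply: runs_seq; apply: runs_iset; apply: (H N 0%N) => //; exact: addn0.
elim: m => [|m IH] i st' hm hi.
  exists st', 1%N; split; [|by lra|by rewrite -hm].
  apply: EWhileFalse; have [/= -> ->] := hI _ _ hi.
  by rewrite -leqNgt -hm.
have iN : (i < N)%N by lia.
have [st1 [t1 [e1 l1 p1]]] := step _ _ hi iN.
have hm' : (m + i.+1 = N)%N by lia.
have [st2 [t2 [e2 l2 p2]]] := IH _ _ hm' p1.
exists st2, (t1 + 1 + t2).+1; split=> //.
  have -> : (m.+1 * q = (q + 0) + m * q)%N by rewrite mulSn addn0.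
  apply: EWhileTrue e2; first by have [/= -> ->] := hI _ _ hi.
  by apply: ESeq e1 _; exact: EISet.
rewrite -(natr1 (t1 + 1 + t2)%N) -(natr1 m) !natrD; lra.
Qed.

End Runs.

(** * Lower bound on [omega] by counting changed cells *)

Section WriteCount.
Variables (R : realType) (P : program) (orc : nat -> nat -> R) (n : nat).
Implicit Types (st : state R) (m : nat -> nat -> nat -> R).

(** Only an [n] by [n] window of one array is observed, which makes the count finite although the
    memory is not. *)
Definition changed (a : nat) m m' : {set 'I_n * 'I_n} :=
  [set ij : 'I_n * 'I_n | m a ij.1 ij.2 != m' a ij.1 ij.2].

Lemma changed_trans a m1 m2 m3 :
  (#|changed a m1 m3| <= #|changed a m1 m2| + #|changed a m2 m3|)%N.
Proof.
apply: leq_trans (leq_card_setU _ _); apply: subset_leq_card.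
apply/fintype.subsetP => ij; rewrite !inE; apply: contraR.
by rewrite negb_or !negbK => /andP[/eqP -> /eqP ->].
Qed.

Lemma changed_refl a m : #|changed a m m| = 0%N.
Proof. by apply/eqP; rewrite cards_eq0 -finset.subset0; apply/fintype.subsetP => ij; rewrite !inE eqxx. Qed.

Lemma changed_rset a st b i j (x : R) :
  (#|changed a (rmem st) (rmem (rset st b i j x))| <= 1)%N.
Proof.
apply/card_le1_eqP => -[i1 j1] [i2 j2]; rewrite !inE /=.
case: ifP => [/and3P[_ /eqP e1 /eqP e2] _|_]; last by rewrite eqxx.
case: ifP => [/and3P[_ /eqP e3 /eqP e4] _|_]; last by rewrite eqxx.
by congr (_, _); apply: val_inj; rewrite /= ?e1 ?e2 ?e3 ?e4.
Qed.

Lemma card_ord_range (r0 r : nat) : (#|[set i : 'I_n | r0 <= i < r0 + r]| <= r)%N.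
Proof.
rewrite -[leqRHS](size_iota r0) cardE -(size_map val); apply: uniq_leq_size.
  by rewrite map_inj_uniq ?enum_uniq //; exact: val_inj.
by move=> x /mapP[i]; rewrite mem_enum inE mem_iota => h ->.
Qed.

Lemma changed_write_block a st b src m :
  (#|changed a m (write_block st b src m)| <= block_cells st b)%N.
Proof.
set S1 := [set i : 'I_n | (ieval st (brow0 b) <= i <
  ieval st (brow0 b) + ieval st (brows b))%N].
set S2 := [set i : 'I_n | (ieval st (bcol0 b) <= i <
  ieval st (bcol0 b) + ieval st (bcols b))%N].
apply: (@leq_trans #|finset.setX S1 S2|).
  apply: subset_leq_card; apply/fintype.subsetP => -[i j]; rewrite !inE /write_block /=.
  by case: ifP => [/and3P[_ -> ->]//|_]; rewrite eqxx.
by rewrite cardsX leq_mul // card_ord_range.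
Qed.

Lemma changed_return a st st' outs :
  (#|changed a (rmem st) (rmem (return_state st st' outs))|
     <= blocks_cells st outs)%N.
Proof.
rewrite /return_state /= /blocks_cells.
elim: outs 0%N (rmem st) => [|b outs IH] l m /=; first by rewrite changed_refl.
apply: leq_trans (leq_add (changed_write_block a st b (rmem st' l) m) (IH _ _)).
exact: changed_trans.
Qed.

Lemma changed_exec a c st st' t q : exec P orc c st st' t q ->
  (#|changed a (rmem st) (rmem st')| <= t)%N.
Proof.
elim=> {c st st' t q}.
- by move=> st; rewrite changed_refl.
- by move=> st b i e; rewrite changed_refl.
- by move=> st b i j e; exact: changed_rset.
- by move=> st b i j u v; exact: changed_rset.
- move=> st st1 st2 c1 c2 t1 t2 q1 q2 _ h1 _ h2.
  exact: leq_trans (changed_trans _ _ _ _) (leq_add h1 h2).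
- by move=> st st1 b c1 c2 t q _ _ h; exact: leqW.
- by move=> st st1 b c1 c2 t q _ _ h; exact: leqW.
- move=> st st1 st2 b c t1 t2 q1 q2 _ _ h1 _ h2; apply: leqW.
  exact: leq_trans (changed_trans _ _ _ _) (leq_add h1 h2).
- by move=> st b c _; rewrite changed_refl.
(* The callee writes into its own memory; only result blocks reach the caller, and each of their
   cells is paid for. *)
- move=> st st1 f ia ins outs t q _ _.
  apply: leq_trans (changed_return _ _ _ _) _; lia.
Qed.

End WriteCount.

Lemma matmul_exponent_ge2 (R : realType) (omega : R) :
  matmul_exponent omega -> 2 <= omega.
Proof.
move=> [Q [C hQ]].
have lb n : (0 < n)%N -> n%:R ^+ 2 <= C * n%:R `^ omega.
  (* All entries of this product equal [n], while the output array is zero at the start. *)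
  move=> n0; have [st [t [e r b]]] := hQ (fun _ _ => 0) n (const_mx 1) (const_mx 1) n0.
  apply: le_trans b; rewrite -natrX ler_nat.
  apply: leq_trans (changed_exec n 2 e).
  have -> : changed n 2 (rmem (matmul_input (const_mx 1 : 'M[R]_n) (const_mx 1))) (rmem st)
    = [set: 'I_n * 'I_n].
    apply/finset.setP => -[i j]; rewrite !inE /= r mxE eq_sym.
    under eq_bigr => k _ do rewrite !mxE mulr1.
    by rewrite sumr_const card_ord pnatr_eq0 -lt0n.
  by rewrite cardsT card_prod !card_ord mulnn.
rewrite leNgt; apply/negP => w2.
(* Chosen so that [x] to the power [2 - omega] is the absolute value of [C] plus 1; any [n] above
   [x] then violates the bound [lb]. *)
pose x := (`|C| + 1) `^ (2 - omega)^-1.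
pose n := (Num.trunc x).+1.
have xn : x < n%:R by rewrite truncnS_gt.
have n0 : (0 : R) < n%:R by rewrite ltr0n.
have := lb n isT.
have -> : (n%:R : R) ^+ 2 = n%:R `^ (2 - omega) * n%:R `^ omega.
  by rewrite -powRD ?subrK ?powR_mulrn ?ler0n //; apply/implyP; rewrite gt_eqF.
rewrite ler_pM2r ?powR_gt0 // leNgt => /negP; apply.
have d0 : 0 < 2 - omega by rewrite subr_gt0.
have : x `^ (2 - omega) < n%:R `^ (2 - omega).
  by apply: gt0_ltr_powR => //; rewrite ?nnegrE ?powR_ge0 // ltW.
apply: le_lt_trans; rewrite /x -powRrM mulVf ?gt_eqF // powRr1; last first.
  by rewrite addr_ge0.
by apply: le_trans (ler_norm _) _; rewrite lerDl.
Qed.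

(** * Cost of the two halves of a recursive call *)

Section HalfPower.
Variables (R : realType) (omega : R).
Hypothesis w2 : 2 <= omega.

Lemma sqr_le_powR (n : nat) : (0 < n)%N -> (n%:R ^+ 2 : R) <= n%:R `^ omega.
Proof.
by move=> n0; rewrite -powR_mulrn ?ler0n // ler_powR // ler1n.
Qed.

(** As [omega] is at least 2 and both ratios to [m] are at most 1, their powers are bounded by their
    squares. The worst case is [m = 3], split into 1 and 2, which gives [(1 + 4) / 9]. *)
Lemma powR_half (m : nat) : (1 < m)%N ->
  m./2%:R `^ omega + (m - m./2)%:R `^ omega <= 5 / 9 * m%:R `^ omega.
Proof.
move=> m1; have m0 : (0 : R) < m%:R by rewrite ltr0n; lia.
have part (a : nat) : (a <= m)%N ->
    a%:R `^ omega <= a%:R ^+ 2 / m%:R ^+ 2 * (m%:R `^ omega : R).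
  move=> am; have -> : (a%:R : R) = a%:R / m%:R * m%:R by rewrite divfK ?gt_eqF.
  rewrite powRM ?divr_ge0 ?ler0n // divfK ?gt_eqF // -expr_div_n.
  rewrite ler_wpM2r ?powR_ge0 //.
  rewrite -powR_mulrn ?divr_ge0 ?ler0n //.
  (* A zero base has power 0 only when the exponent is nonzero. *)
  have [->|a0] := eqVneq a 0%N.
    have w0 : omega != 0 by apply/eqP => w0; move: w2; rewrite w0; lra.
    by rewrite mul0r !powR0 ?pnatr_eq0.
  apply: ger_powR => //; apply/andP; split; first by rewrite divr_gt0 // ltr0n lt0n.
  by rewrite ler_pdivrMr // mul1r ler_nat.
apply: le_trans (lerD (part m./2 _) (part (m - m./2)%N _)) _; [lia|lia|].
rewrite -mulrDl ler_wpM2r ?powR_ge0 // -mulrDl ler_pdivrMr ?exprn_gt0 //.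
rewrite -!natrX -natrD mulrAC ler_pdivlMr // -!natrM ler_nat.
have := odd_double_half m; move: m1.
set h := m./2; case: (odd m) => /=; rewrite -muln2 => m1 e; nia.
Qed.

End HalfPower.

(** * The programs *)

Notation ivar a := (IGet a (ILit 0)).

(** As an argument it reads as the zero matrix; as a result it discards the array at its position.
    Either way no cell is charged. *)
Definition empty_block : block := Block 0 (ILit 0) (ILit 0) (ILit 0) (ILit 0).
Definition corner_block (a : nat) (r c : iexp) : block :=
  Block a (ILit 0) (ILit 0) r c.

(* Array 0 := array 0 + array 1 * array 2; procedure 4 is the entry point of
   the linked matrix multiplication program. *)
Definition fma_body : cmd :=
  Seq (Call 4 [:: ivar 0]
         [:: corner_block 1 (ivar 0) (ivar 0); corner_block 2 (ivar 0) (ivar 0)]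
         [:: empty_block; empty_block; corner_block 3 (ivar 0) (ivar 0)])
    (For 1 (ivar 0) (For 2 (ivar 0)
      (RSet 0 (ivar 1) (ivar 2)
        (RAdd (RGet 0 (ivar 1) (ivar 2)) (RGet 3 (ivar 1) (ivar 2)))))).

(* Minus the inverse of array 0, in place. With [[A, B], [C, D]] the halves of
   the input, N = - A^-1, F = N B, E = C N, S = D + C F and T = - S^-1, the
   result is [[N + F T E, F T], [T E, T]]. *)
Definition neg_split : cmd :=
  let p := ivar 1 in let q := ivar 2 in
  let bA := Block 0 (ILit 0) (ILit 0) p p in
  let bB := Block 0 (ILit 0) p p q in
  let bC := Block 0 p (ILit 0) q p in
  let bD := Block 0 p p q q in
  let bF := corner_block 1 p q in
  let bE := corner_block 2 q p in
  Seq (Call 2 [:: p] [:: bA] [:: bA])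
  (Seq (Call 3 [:: ivar 0] [:: empty_block; bA; bB] [:: bF])
  (Seq (Call 3 [:: ivar 0] [:: empty_block; bC; bA] [:: bE])
  (Seq (Call 3 [:: ivar 0] [:: bD; bC; bF] [:: bD])
  (Seq (Call 2 [:: q] [:: bD] [:: bD])
  (Seq (Call 3 [:: ivar 0] [:: empty_block; bF; bD] [:: bB])
  (Seq (Call 3 [:: ivar 0] [:: empty_block; bD; bE] [:: bC])
       (Call 3 [:: ivar 0] [:: bA; bB; bE] [:: bA]))))))).

Definition neg_body : cmd :=
  If (BILt (ILit 1) (ivar 0))
    (Seq (ISet 1 (ILit 0) (IHalf (ivar 0)))
    (Seq (ISet 2 (ILit 0) (ISub (ivar 0) (ivar 1))) neg_split))
    (RSet 0 (ILit 0) (ILit 0)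
      (RSub RZero (RDiv ROne (RGet 0 (ILit 0) (ILit 0))))).

(* From an adjacency matrix in array 0, array 2 := its Laplacian plus the
   all-ones matrix M, array 3 := identity; then array 0 := the alleged - M^-1,
   and cell (0, 0) of array 1 := the sum of squared entries of I + M X. *)
Definition try_body : cmd :=
  let n := ivar 0 in let i := ivar 1 in let j := ivar 2 in
  Seq (For 1 n
    (Seq (For 2 n (RSet 2 i j (RSub ROne (RGet 0 i j))))
    (Seq (For 2 n (RSet 2 i i (RAdd (RGet 2 i i) (RGet 0 i j))))
         (RSet 3 i i ROne))))
  (Seq (Call 2 [:: n] [:: corner_block 2 n n] [:: corner_block 0 n n])
  (Seq (Call 3 [:: n]
          [:: corner_block 3 n n; corner_block 2 n n; corner_block 0 n n]
          [:: corner_block 4 n n])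
    (For 1 n (For 2 n
      (RSet 1 (ILit 0) (ILit 0)
        (RAdd (RGet 1 (ILit 0) (ILit 0))
              (RMul (RGet 4 i j) (RGet 4 i j)))))))).

(* Digit [i] of the current candidate is in integer array 3, the measured
   resistances in real array 3, the residual to be annihilated in cell (0, 0)
   of real array 5. *)
Definition main_weight : rexp := RGet 1 (IGet 3 (ivar 4)) (ILit 0).

Definition main_fill : cmd :=
  let u := IGet 1 (ivar 4) in let v := IGet 2 (ivar 4) in
  For 4 (IGet 0 (ILit 2))
    (Seq (RSet 0 u v main_weight)
    (Seq (RSet 0 v u main_weight) (RSet 2 (ivar 4) (ILit 0) main_weight))).

(** Array 4 holds the alleged [- M^-1], so the measured resistance plus the form [d] reads from it
    must vanish. A negative weight adds 1, which no later term can cancel. *)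
Definition main_check : cmd :=
  let u := IGet 1 (ivar 4) in let v := IGet 2 (ivar 4) in
  let acc := RGet 5 (ILit 0) (ILit 0) in
  let d := RAdd (RGet 3 (ivar 4) (ILit 0))
     (RSub (RSub (RAdd (RGet 4 u u) (RGet 4 v v)) (RGet 4 u v)) (RGet 4 v u)) in
  For 4 (IGet 0 (ILit 2))
    (Seq (RSet 5 (ILit 0) (ILit 0) (RAdd acc (RMul d d)))
      (If (BRLt main_weight RZero)
        (RSet 5 (ILit 0) (ILit 0) (RAdd acc ROne)) Skip)).

(** Adds one in base [s], least significant digit first. After the last candidate the carry lands at
    position [k], beyond the digits in use. *)
Definition main_next : cmd :=
  let i := ivar 4 in
  Seq (ISet 4 (ILit 0) (ILit 0))
  (Seq (While (BAnd (BILt i (IGet 0 (ILit 2)))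
                    (BNot (BILt (IAdd (IGet 3 i) (ILit 1)) (IGet 0 (ILit 1)))))
          (Seq (ISet 3 i (ILit 0)) (ISet 4 (ILit 0) (IAdd i (ILit 1)))))
       (ISet 3 i (IAdd (IGet 3 i) (ILit 1)))).

Definition main_step : cmd :=
  let n := ivar 0 in
  Seq main_fill
  (Seq (Call 1 [:: n] [:: corner_block 0 n n]
     [:: corner_block 4 n n; corner_block 5 (ILit 1) (ILit 1)])
  (Seq main_check main_next)).

(** The residual is set to 1 to force a first round, also when [k = 0]. The loop counts nothing: the
    true assignment guarantees that it stops. *)
Definition main_body : cmd :=
  Seq (For 4 (IGet 0 (ILit 2))
    (Query 3 (ivar 4) (ILit 0) (IGet 1 (ivar 4)) (IGet 2 (ivar 4))))
  (Seq (RSet 5 (ILit 0) (ILit 0) ROne)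
    (While (BRLt RZero (RGet 5 (ILit 0) (ILit 0))) main_step)).

Definition reconstruct (Q : program) : program :=
  link [:: main_body; try_body; neg_body; fma_body] Q.

(** * Matrices stored in rectangular blocks of memory *)

Section Blocks.
Variable R : realType.
Implicit Types (st : state R) (b : block) (e : iexp).

Definition mxget p q (M : 'M[R]_(p, q)) (i j : nat) : R :=
  if (insub i, insub j) is (Some i', Some j') then M i' j' else 0.

Definition amat st a p q : 'M[R]_(p, q) := \matrix_(i, j) rmem st a i j.

Definition bmat st b p q : 'M[R]_(p, q) := \matrix_(i, j) read_block st b i j.

Definition upd st b p q (M : 'M[R]_(p, q)) : state R :=
  State (imem st) (write_block st b (mxget M) (rmem st)).

Definition block_dims st b p q : Prop :=
  ieval st (brows b) = p /\ ieval st (bcols b) = q.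

Lemma mxgetE p q (M : 'M[R]_(p, q)) (i : 'I_p) (j : 'I_q) : mxget M i j = M i j.
Proof. by rewrite /mxget !valK. Qed.

Lemma mxget_amat st a p q i j : (i < p)%N -> (j < q)%N ->
  mxget (amat st a p q) i j = rmem st a i j.
Proof. by move=> hi hj; rewrite (mxgetE _ (Ordinal hi) (Ordinal hj)) mxE. Qed.

Lemma ieval_imem st st' e : imem st = imem st' -> ieval st e = ieval st' e.
Proof.
move=> h; elim: e => //= [a e ->|e1 -> e2 ->|e1 -> e2 ->|e ->] //.
by rewrite h.
Qed.

Lemma ieval_upd st b p q (M : 'M[R]_(p, q)) e : ieval (upd st b M) e = ieval st e.
Proof. exact: ieval_imem. Qed.

Lemma return_state1 st st' b p q : block_dims st b p q ->
  return_state st st' [:: b] = upd st b (amat st' 0 p q).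
Proof.
move=> [hp hq]; rewrite /return_state /upd /=; congr State.
apply/funext => a; apply/funext => i; apply/funext => j; rewrite /write_block.
rewrite hp hq; case: ifP => // /and3P[_ hi hj].
by rewrite mxget_amat //; lia.
Qed.

Lemma bmat_upd_same st b p q (M : 'M[R]_(p, q)) : block_dims st b p q ->
  bmat (upd st b M) b p q = M.
Proof.
move=> [hp hq]; apply/matrixP => i j; rewrite mxE /read_block !ieval_upd hp hq.
rewrite !ltn_ord /= /write_block eqxx hp hq !leq_addr !ltn_add2l !ltn_ord /=.
by rewrite !addKn mxgetE.
Qed.

Definition disjoint_blocks st b b' : bool :=
  [|| barr b != barr b',
      ieval st (brow0 b) + ieval st (brows b) <= ieval st (brow0 b'),
      ieval st (brow0 b') + ieval st (brows b') <= ieval st (brow0 b),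
      ieval st (bcol0 b) + ieval st (bcols b) <= ieval st (bcol0 b') |
      ieval st (bcol0 b') + ieval st (bcols b') <= ieval st (bcol0 b)]%N.

Lemma bmat_upd_disj st b b' p q p' q' (M : 'M[R]_(p, q)) :
  disjoint_blocks st b b' -> bmat (upd st b M) b' p' q' = bmat st b' p' q'.
Proof.
move=> D; apply/matrixP => i j; rewrite !mxE /read_block !ieval_upd.
case: ifP => // /andP[hi hj]; rewrite /= /write_block ifF //.
apply/negP => /and3P[/eqP ea h1 h2].
move: D; rewrite /disjoint_blocks ea eqxx /=; lia.
Qed.

Lemma bmat_empty st p q : bmat st empty_block p q = 0.
Proof. by apply/matrixP => i j; rewrite !mxE. Qed.

Lemma amat_call st ia b p q : amat (call_state st ia [:: b]) 0 p q = bmat st b p q.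
Proof. by apply/matrixP => i j; rewrite !mxE. Qed.

Lemma bmat_corner st a r c p q : ieval st r = p -> ieval st c = q ->
  bmat st (corner_block a r c) p q = amat st a p q.
Proof.
by move=> hr hc; apply/matrixP => i j; rewrite !mxE /read_block /= hr hc !ltn_ord.
Qed.

(** Rectangular products come from a square multiplication by zero padding: reads outside a block
    return 0, so the columns of [bY] beyond [r] contribute nothing. *)
Lemma mulmx_bmat_widen st bY bZ p q r m (i : 'I_p) (j : 'I_q)
    (im : (i < m)%N) (jm : (j < m)%N) : (r <= m)%N -> ieval st (bcols bY) = r ->
  (bmat st bY m m *m bmat st bZ m m) (Ordinal im) (Ordinal jm) =
  (bmat st bY p r *m bmat st bZ r q) i j.
Proof.
move=> rm dY; rewrite !mxE; pose F l := read_block st bY i l * read_block st bZ l j.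
rewrite (eq_bigr (fun l : 'I_m => F l)) => [|l _]; last by rewrite !mxE.
rewrite [RHS](eq_bigr (fun l : 'I_r => F l)) => [|l _]; last by rewrite !mxE.
rewrite (big_ord_widen m F rm) [RHS]big_mkcond /=; apply: eq_bigr => l _.
case: ifP => // /negbT lr; rewrite /F /read_block.
by rewrite dY (negPf lr) andbF mul0r.
Qed.

End Blocks.

Definition multiplies_within (R : realType) (omega C : R) (Q : program) : Prop :=
  forall (orc : nat -> nat -> R) (n : nat) (A B : 'M[R]_n), (0 < n)%N ->
  exists (st : state R) (t : nat),
    [/\ run Q orc (matmul_input A B) st t 0%N,
        forall i j : 'I_n, rmem st 2%N i j = (A *m B) i j
      & t%:R <= C * n%:R `^ omega].

(** * Correctness and cost of the matrix procedures *)

Section Procedures.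
Variables (R : realType) (omega C : R) (Q : program).
Hypothesis w2 : 2 <= omega.
Hypothesis C0 : 0 <= C.
Hypothesis hQ : multiplies_within omega C Q.
Variable orc : nat -> nat -> R.
Implicit Types (st : state R) (e : iexp).

Let P := reconstruct Q.
Let pw (n : nat) : R := n%:R `^ omega.

Lemma powR_nat_ge1 n : (0 < n)%N -> 1 <= pw n.
Proof.
move=> n0; apply: le_trans (sqr_le_powR w2 n0).
by rewrite -natrX ler1n expn_gt0 n0.
Qed.

Lemma natr_le_powR n m : (0 < n)%N -> (m <= n * n)%N -> m%:R <= pw n.
Proof.
move=> n0 h; apply: le_trans (sqr_le_powR w2 n0).
by rewrite -natrX ler_nat -mulnn.
Qed.

Lemma call_state_matmul st em a1 a2 m : ieval st em = m ->
  call_state st [:: em] [:: corner_block a1 em em; corner_block a2 em em] =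
  matmul_input (amat st a1 m m) (amat st a2 m m).
Proof.
move=> hm; rewrite /call_state /matmul_input; congr State.
  apply/funext => a; apply/funext => i /=; rewrite hm.
  by case: a => [|a] //; case: i => [|[|i]].
have E (a : nat) : read_block st (corner_block a em em) = mx_array (amat st a m m).
  apply/funext => i; apply/funext => j; rewrite /read_block /mx_array /= hm.
  case: insubP => [i' -> <-|/negPf -> //]; case: insubP => [j' -> <-|/negPf ->] //=.
  by rewrite mxE.
apply/funext => a /=; rewrite -!E; case: a => [|[|a]] //=; first by rewrite nth_nil.
Qed.

Lemma runs_matmul st em a1 a2 m : ieval st em = m -> (0 < m)%N ->
  runs P orc (nth Skip P 4)
    (call_state st [:: em] [:: corner_block a1 em em; corner_block a2 em em])
    (C * pw m) 0
    (fun st' => amat st' 2 m m = amat st a1 m m *m amat st a2 m m).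
Proof.
move=> hm m0; rewrite (call_state_matmul _ _ hm).
have [st' [t [h1 h2 h3]]] := hQ orc (amat st a1 m m) (amat st a2 m m) m0.
exists st', t; split=> //; last by apply/matrixP => i j; rewrite -h2 mxE.
rewrite (nth_link [:: main_body; try_body; neg_body; fma_body] Q 0).
exact: exec_link h1.
Qed.

Lemma runs_fma_body st m : imem st 0%N 0%N = m -> (0 < m)%N ->
  runs P orc fma_body st ((C + 16) * pw m) 0 (fun st' =>
    amat st' 0 m m = amat st 0 m m + amat st 1 m m *m amat st 2 m m).
Proof.
move=> hm m0; set M := amat st 1 m m *m amat st 2 m m.
have T1 : m%:R * m%:R <= pw m by rewrite -natrM; apply: natr_le_powR.
have T2 : m%:R <= pw m by apply: natr_le_powR; rewrite // leq_pmulr.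
have T3 := powR_nat_ge1 m0.
apply: (@runs_conseq _ _ _ _ _
   (((1 + blocks_cells st [:: corner_block 1 (ivar 0) (ivar 0); corner_block 2 (ivar 0) (ivar 0)]
     + blocks_cells st [:: empty_block; empty_block; corner_block 3 (ivar 0) (ivar 0)]).+1%:R + C * pw m)
    + (m%:R * ((m%:R * (1 + 2) + 2) + 2) + 2)) _ (0 + m * (m * 0))); [| |lia|by move=> ? h; exact: h].
  apply: runs_seq; apply: runs_call.
  apply: runs_conseq (runs_matmul 1 2 (em := ivar 0) hm m0) _ _ _ => //.
  move=> st1 h1; set st2 := return_state _ _ _.
  have I0 : imem st2 = imem st by [].
  have M0 a b : rmem st2 0%N a b = rmem st 0%N a b by rewrite /st2 /= /write_block /= ?andbF ?ltnn.
  have M3 a b : (a < m)%N -> (b < m)%N -> rmem st2 3%N a b = mxget M a b.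
    move=> ha hb; rewrite /st2 /= /write_block /= hm !add0n ha hb !subn0.
    by rewrite /M -h1 mxget_amat.
  pose Inv (i j : nat) st' := [/\ imem st' 0%N 0%N = m, imem st' 1%N 0%N = i,
     rmem st' 3%N = rmem st2 3%N & forall a b, rmem st' 0%N a b =
       rmem st 0%N a b + (if (b < m)%N && ((a < i)%N || (a == i) && (b < j)%N)
                          then mxget M a b else 0)].
  apply: runs_conseq (_ : runs P orc _ st2 _ _ (Inv m 0%N)) _ _ _; [|exact: lexx|by []|]; last first.
    move=> st' [_ _ _ h]; apply/matrixP => i j.
    by rewrite !mxE h !ltn_ord /= mxgetE mxE.
  apply: (runs_for (Inv := fun i st' => Inv i 0%N st')).
  - by move=> i st' [].
  - move=> i st' Hi im.
    apply: runs_conseq (_ : runs P orc _ st' _ _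
      (fun st' => Inv i m st' /\ imem st' 2%N 0%N = m)) _ _ _; [|exact: lexx|by []|]; last first.
      move=> st3 [[h1' h2' h3' h4'] _]; split=> //=; first by rewrite h2' addn1.
      move=> a b; rewrite h4'; congr (_ + _); congr (if _ then _ else _).
      by apply/idP/idP; lia.
    apply: (runs_for (Inv := fun j st' => Inv i j st' /\ imem st' 2%N 0%N = j)).
    + by move=> j st3 [[]].
    + move=> j st3 [[h1' h2' h3' h4'] h5'] jm; apply: runs_rset.
      split; last by rewrite /= h5' addn1.
      split=> //= a b; rewrite h2' h5' h3'.
      case: ifP => [/andP[/eqP -> /eqP ->]|ne].
        by rewrite h4' M3 // jm ltnn eqxx ltnn ltnSn /= addr0.
      rewrite h4'; congr (_ + _); congr (if _ then _ else _).
      by case: (eqVneq a i) ne => //= _ ne; rewrite ltnS (leq_eqVlt b) ne.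
    + by case: Hi.
  - split=> // a b; rewrite [LHS]M0 ifF ?addr0 //.
    by rewrite !ltn0 andbF orbF andbF.
have -> : blocks_cells st [:: corner_block 1 (ivar 0) (ivar 0); corner_block 2 (ivar 0) (ivar 0)] = (m * m + m * m)%N.
  by rewrite /blocks_cells /block_cells /= hm; lia.
have -> : blocks_cells st [:: empty_block; empty_block; corner_block 3 (ivar 0) (ivar 0)] = (m * m)%N.
  by rewrite /blocks_cells /block_cells /= hm; lia.
rewrite -natr1 !natrD !natrM; lra.
Qed.

Lemma runs_fma st em bX bY bZ bO m p q r :
  ieval st em = m -> (0 < m)%N -> (p <= m)%N -> (q <= m)%N -> (r <= m)%N ->
  (block_cells st bX <= m * m)%N ->
  block_dims st bY p r -> block_dims st bZ r q -> block_dims st bO p q ->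
  runs P orc (Call 3 [:: em] [:: bX; bY; bZ] [:: bO]) st ((C + 22) * pw m) 0
    (fun st' => st' = upd st bO
       (bmat st bX p q + bmat st bY p r *m bmat st bZ r q)).
Proof.
move=> hm m0 pm qm rm cX dY dZ dO.
set cs := call_state st [:: em] [:: bX; bY; bZ].
have := @runs_fma_body cs m hm m0 => h.
apply: runs_conseq (runs_call (f := 3) (outs := [:: bO])
  (T := (C + 16) * pw m) (q := 0%N)
  (Post := fun st' => st' = upd st bO
       (bmat st bX p q + bmat st bY p r *m bmat st bZ r q)) _) _ _ _ => //.
  apply: runs_conseq h _ _ _ => // st1 e1; rewrite (return_state1 _ dO).
  congr upd; apply/matrixP => i j.
  have im : (i < m)%N := leq_trans (ltn_ord i) pm.
  have jm : (j < m)%N := leq_trans (ltn_ord j) qm.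
  rewrite mxE -(mxget_amat st1 0 im jm) e1.
  rewrite (mxgetE _ (Ordinal im) (Ordinal jm)) mxE [RHS]mxE.
  congr (_ + _); first by rewrite !mxE.
  rewrite -(@mulmx_bmat_widen _ st bY bZ _ _ _ _ i j im jm rm (proj2 dY)).
  have -> : amat cs 1 m m = bmat st bY m m by apply/matrixP => x y; rewrite !mxE.
  by have -> : amat cs 2 m m = bmat st bZ m m by apply/matrixP => x y; rewrite !mxE.
have T1 : m%:R * m%:R <= pw m by rewrite -natrM; apply: natr_le_powR.
have T3 := powR_nat_ge1 m0.
have cells (b : block) x y : block_dims st b x y -> (x <= m)%N -> (y <= m)%N ->
  (block_cells st b <= m * m)%N.
  by move=> [hx hy] xm ym; rewrite /block_cells hx hy leq_mul.
have : (size [:: em] + blocks_cells st [:: bX; bY; bZ] + blocks_cells st [:: bO] <= 1 + 4 * (m * m))%N.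
  rewrite /blocks_cells /=.
  have := cells _ _ _ dY pm rm; have := cells _ _ _ dZ rm qm; have := cells _ _ _ dO pm qm; lia.
set N := (_ + _ + _)%N; move=> hN.
have {}hN : N%:R <= 1 + 4 * (m%:R * m%:R) :> R.
  by rewrite -!natrM nat1r ler_nat.
rewrite -natr1; lra.
Qed.

(** For other matrices only termination and cost are promised: a zero pivot yields 0, and the
    residual judges the result. *)
Definition neg_post st m st' : Prop :=
  posdef (amat st 0 m m) -> neg_inverse (amat st 0 m m) (amat st' 0 m m).

(** Solves [K = 5/9 K + 6 (C + 22) + 12]: one level makes six calls to procedure 3, and 12 covers
    block copies and control. The factor is [1 / (1 - 5/9)], from [powR_half]. *)
Definition neg_cost : R := 9 / 4 * (6 * (C + 22) + 12).

Definition neg_spec (m : nat) : Prop := forall st, imem st 0%N 0%N = m ->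
  runs P orc neg_body st (neg_cost * pw m) 0 (neg_post st m).

Lemma runs_neg st em bX bO m : neg_spec m -> ieval st em = m ->
  block_dims st bX m m -> block_dims st bO m m ->
  runs P orc (Call 2 [:: em] [:: bX] [:: bO]) st
    (2 + 2 * (m%:R * m%:R) + neg_cost * pw m) 0
    (fun st' => exists2 X : 'M[R]_m, st' = upd st bO X &
       posdef (bmat st bX m m) -> neg_inverse (bmat st bX m m) X).
Proof.
move=> h hm dX dO.
apply: runs_conseq (runs_call (f := 2) (outs := [:: bO])
  (T := neg_cost * pw m) (q := 0%N)
  (Post := fun st' => exists2 X : 'M[R]_m, st' = upd st bO X &
       posdef (bmat st bX m m) -> neg_inverse (bmat st bX m m) X) _) _ _ _ => //.
  apply: runs_conseq (h (call_state st [:: em] [:: bX]) hm) _ _ _ => // st1.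
  rewrite /neg_post amat_call => h1; exists (amat st1 0 m m) => //.
  exact: return_state1.
rewrite lerD2r /blocks_cells /block_cells /=.
have [-> ->] := dX; have [-> ->] := dO.
rewrite !addn0 -natr1 !natrD !natrM; lra.
Qed.

Lemma amat_split st p q : imem st 1%N 0%N = p -> imem st 2%N 0%N = q ->
  amat st 0 (p + q) (p + q) =
  block_mx (bmat st (Block 0 (ILit 0) (ILit 0) (ivar 1) (ivar 1)) p p)
           (bmat st (Block 0 (ILit 0) (ivar 1) (ivar 1) (ivar 2)) p q)
           (bmat st (Block 0 (ivar 1) (ILit 0) (ivar 2) (ivar 1)) q p)
           (bmat st (Block 0 (ivar 1) (ivar 1) (ivar 2) (ivar 2)) q q).
Proof.
move=> hp hq; apply/matrixP => i j; rewrite mxE.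
case: (split_ordP i) => k ->; case: (split_ordP j) => l ->;
  by rewrite ?block_mxEul ?block_mxEur ?block_mxEdl ?block_mxEdr mxE
    /read_block /= ?hp ?hq !ltn_ord.
Qed.

Ltac disjointness :=
  rewrite /disjoint_blocks /=;
  repeat match goal with h : imem _ _ _ = _ |- _ => rewrite h end; lia.

(** Working in place is safe because [bB] and [bC] are overwritten only after F, E and the Schur
    complement have been formed, and F and E live in arrays of their own. *)
Lemma runs_neg_split st p q : neg_spec p -> neg_spec q ->
  imem st 0%N 0%N = (p + q)%N -> imem st 1%N 0%N = p -> imem st 2%N 0%N = q ->
  (0 < p)%N -> (0 < q)%N ->
  runs P orc neg_split st
    (neg_cost * (pw p + pw q) + (6 * (C + 22) + 8) * pw (p + q)) 0
    (neg_post st (p + q)).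
Proof.
move=> hnp hnq h0 h1 h2 p0 q0; rewrite /neg_split.
set bA := Block 0 (ILit 0) (ILit 0) (ivar 1) (ivar 1).
set bB := Block 0 (ILit 0) (ivar 1) (ivar 1) (ivar 2).
set bC := Block 0 (ivar 1) (ILit 0) (ivar 2) (ivar 1).
set bD := Block 0 (ivar 1) (ivar 1) (ivar 2) (ivar 2).
set bF := corner_block 1 (ivar 1) (ivar 2).
set bE := corner_block 2 (ivar 2) (ivar 1).
set m := (p + q)%N.
have m0 : (0 < m)%N by rewrite addn_gt0 p0.
have pm : (p <= m)%N by rewrite leq_addr.
have qm : (q <= m)%N by rewrite leq_addl.
pose good (s : state R) := [/\ ieval s (ivar 0) = m, ieval s (ivar 1) = p & ieval s (ivar 2) = q].
have gupd (s : state R) (b : block) x y (M : 'M[R]_(x, y)) : good s -> good (upd s b M) by [].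
have dA (s : state R) : good s -> block_dims s bA p p by case.
have dB (s : state R) : good s -> block_dims s bB p q by case.
have dC (s : state R) : good s -> block_dims s bC q p by case.
have dD (s : state R) : good s -> block_dims s bD q q by case.
have dF (s : state R) : good s -> block_dims s bF p q by case.
have dE (s : state R) : good s -> block_dims s bE q p by case.
have cX (s : state R) b x y : block_dims s b x y -> (x <= m)%N -> (y <= m)%N ->
  (block_cells s b <= m * m)%N.
  by move=> [hx hy] xm ym; rewrite /block_cells hx hy leq_mul.
have cE (s : state R) : (block_cells s empty_block <= m * m)%N by [].
have g0 : good st by [].
apply: (@runs_conseq _ _ _ _ _
  ((2 + 2 * (p%:R * p%:R) + neg_cost * pw p) + ((C + 22) * pw m + ((C + 22) * pw m
   + ((C + 22) * pw m + ((2 + 2 * (q%:R * q%:R) + neg_cost * pw q)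
   + ((C + 22) * pw m + ((C + 22) * pw m + (C + 22) * pw m)))))))
  _ (0 + (0 + (0 + (0 + (0 + (0 + (0 + 0)))))))); [| |by []|by move=> ? h; exact: h]; last first.
  have T1 : p%:R * p%:R <= pw m by rewrite -natrM; apply: natr_le_powR => //; apply: leq_mul.
  have T2 : q%:R * q%:R <= pw m by rewrite -natrM; apply: natr_le_powR => //; apply: leq_mul.
  have T3 := powR_nat_ge1 m0; lra.
apply: runs_seq.
apply: runs_conseq (runs_neg (em := ivar 1) (bX := bA) (bO := bA) hnp h1 (dA _ g0) (dA _ g0)) _ _ _ => //.
move=> _ [N -> hN]; set s1 := upd st bA N.
have g1 : good s1 by exact: gupd.
apply: runs_seq.
apply: runs_conseq (runs_fma (st := s1) (em := ivar 0) (bX := empty_block) (bY := bA) (bZ := bB) (bO := bF)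
  (p := p) (r := p) (q := q) h0 m0 pm qm pm (cE _) (dA _ g1) (dB _ g1) (dF _ g1)) _ _ _ => //.
move=> _ ->; set s2 := upd s1 _ _.
have g2 : good s2 by exact: gupd.
apply: runs_seq.
apply: runs_conseq (runs_fma (st := s2) (em := ivar 0) (bX := empty_block) (bY := bC) (bZ := bA) (bO := bE)
  (p := q) (r := p) (q := p) h0 m0 qm pm pm (cE _) (dC _ g2) (dA _ g2) (dE _ g2)) _ _ _ => //.
move=> _ ->; set s3 := upd s2 _ _.
have g3 : good s3 by exact: gupd.
apply: runs_seq.
apply: runs_conseq (runs_fma (st := s3) (em := ivar 0) (bX := bD) (bY := bC) (bZ := bF) (bO := bD)
  (p := q) (r := p) (q := q) h0 m0 qm qm pm (cX _ _ _ _ (dD _ g3) qm qm) (dC _ g3) (dF _ g3) (dD _ g3)) _ _ _ => //.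
move=> _ ->; set s4 := upd s3 _ _.
have g4 : good s4 by exact: gupd.
apply: runs_seq.
apply: runs_conseq (runs_neg (st := s4) (em := ivar 2) (bX := bD) (bO := bD) hnq h2 (dD _ g4) (dD _ g4)) _ _ _ => //.
move=> _ [T -> hT]; set s5 := upd s4 bD T.
have g5 : good s5 by exact: gupd.
apply: runs_seq.
apply: runs_conseq (runs_fma (st := s5) (em := ivar 0) (bX := empty_block) (bY := bF) (bZ := bD) (bO := bB)
  (p := p) (r := q) (q := q) h0 m0 pm qm qm (cE _) (dF _ g5) (dD _ g5) (dB _ g5)) _ _ _ => //.
move=> _ ->; set s6 := upd s5 _ _.
have g6 : good s6 by exact: gupd.
apply: runs_seq.
apply: runs_conseq (runs_fma (st := s6) (em := ivar 0) (bX := empty_block) (bY := bD) (bZ := bE) (bO := bC)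
  (p := q) (r := q) (q := p) h0 m0 qm pm qm (cE _) (dD _ g6) (dE _ g6) (dC _ g6)) _ _ _ => //.
move=> _ ->; set s7 := upd s6 _ _.
have g7 : good s7 by exact: gupd.
apply: runs_conseq (runs_fma (st := s7) (em := ivar 0) (bX := bA) (bY := bB) (bZ := bE) (bO := bA)
  (p := p) (r := q) (q := p) h0 m0 pm pm qm (cX _ _ _ _ (dA _ g7) pm pm) (dB _ g7) (dE _ g7) (dA _ g7)) _ _ _ => //.
move=> _ ->; set s8 := upd s7 _ _.
have step (s : state R) b b' x y x' y' (M : 'M[R]_(x, y)) M' : bmat s b' x' y' = M' ->
    disjoint_blocks s b b' -> bmat (upd s b M) b' x' y' = M'.
  by move=> <- D; rewrite bmat_upd_disj.
(* The number in these names is the stage and the letter the block: each content was either just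
   written or lies off the written block. *)
have E1A : bmat s1 bA p p = N by apply: bmat_upd_same; apply: dA.
have E1B : bmat s1 bB p q = bmat st bB p q by apply: step => //; disjointness.
have E1C : bmat s1 bC q p = bmat st bC q p by apply: step => //; disjointness.
have E1D : bmat s1 bD q q = bmat st bD q q by apply: step => //; disjointness.
have E2F : bmat s2 bF p q = N *m bmat st bB p q.
  by rewrite bmat_upd_same ?bmat_empty ?add0r ?E1A ?E1B //; apply: dF.
have E2A : bmat s2 bA p p = N by apply: step.
have E2C : bmat s2 bC q p = bmat st bC q p by apply: step.
have E2D : bmat s2 bD q q = bmat st bD q q by apply: step.
have E3E : bmat s3 bE q p = bmat st bC q p *m N.
  by rewrite bmat_upd_same ?bmat_empty ?add0r ?E2A ?E2C //; apply: dE.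
have E3F : bmat s3 bF p q = N *m bmat st bB p q by apply: step.
have E3A : bmat s3 bA p p = N by apply: step.
have E3C : bmat s3 bC q p = bmat st bC q p by apply: step.
have E3D : bmat s3 bD q q = bmat st bD q q by apply: step.
have E4D : bmat s4 bD q q =
    bmat st bD q q + bmat st bC q p *m (N *m bmat st bB p q).
  by rewrite bmat_upd_same ?E3D ?E3C ?E3F //; apply: dD.
have E4E : bmat s4 bE q p = bmat st bC q p *m N by apply: step.
have E4F : bmat s4 bF p q = N *m bmat st bB p q by apply: step.
have E4A : bmat s4 bA p p = N by apply: step => //; disjointness.
rewrite E4D in hT.
have E5D : bmat s5 bD q q = T by apply: bmat_upd_same; apply: dD.
have E5E : bmat s5 bE q p = bmat st bC q p *m N by apply: step.
have E5F : bmat s5 bF p q = N *m bmat st bB p q by apply: step.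
have E5A : bmat s5 bA p p = N by apply: step => //; disjointness.
have E6B : bmat s6 bB p q = N *m bmat st bB p q *m T.
  by rewrite bmat_upd_same ?bmat_empty ?add0r ?E5F ?E5D //; apply: dB.
have E6E : bmat s6 bE q p = bmat st bC q p *m N by apply: step.
have E6A : bmat s6 bA p p = N by apply: step => //; disjointness.
have E6D : bmat s6 bD q q = T by apply: step => //; disjointness.
have E7C : bmat s7 bC q p = T *m (bmat st bC q p *m N).
  by rewrite bmat_upd_same ?bmat_empty ?add0r ?E6E ?E6D //; apply: dC.
have E7E : bmat s7 bE q p = bmat st bC q p *m N by apply: step.
have E7A : bmat s7 bA p p = N by apply: step => //; disjointness.
have E7B : bmat s7 bB p q = N *m bmat st bB p q *m T
  by apply: step => //; disjointness.
have E7D : bmat s7 bD q q = T by apply: step => //; disjointness.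
have E8A : bmat s8 bA p p =
    N + N *m bmat st bB p q *m T *m (bmat st bC q p *m N).
  by rewrite bmat_upd_same ?E7A ?E7B ?E7E //; apply: dA.
have E8B : bmat s8 bB p q = N *m bmat st bB p q *m T
  by apply: step => //; disjointness.
have E8C : bmat s8 bC q p = T *m (bmat st bC q p *m N)
  by apply: step => //; disjointness.
have E8D : bmat s8 bD q q = T by apply: step => //; disjointness.
rewrite /neg_post !amat_split // -/bA -/bB -/bC -/bD E8A E8B E8C E8D => pd.
have AN := hN (posdef_block_ul pd).
exact: neg_inverse_block AN (hT (posdef_schur AN pd)).
Qed.

Lemma runs_neg_body m : (0 < m)%N -> neg_spec m.
Proof.
elim/ltn_ind: m => m IH m0 st hm.
have K0 : 0 <= neg_cost by rewrite /neg_cost; have := C0; lra.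
have T3 := powR_nat_ge1 m0.
have [m1|m1] := ltnP 1 m; last first.
  have em : m = 1%N by lia.
  subst m; rewrite em in T3 *.
  apply: (@runs_conseq _ _ _ _ _ (1 + 1) _ 0 0 (neg_post st 1)) => //; last first.
    by rewrite /neg_cost; have := C0; nra.
  apply: runs_if => /=; rewrite em // => _; apply: runs_rset.
  move=> pd; have := neg_inverse1 pd; rewrite /= => /(_ _ erefl); congr neg_inverse.
  apply/matrixP => i j; rewrite !ord1 !mxE /= mulr1n.
  by rewrite sub0r div1r.
set p := m./2; set q := (m - p)%N.
have [p0 q0 pm qm] : [/\ (0 < p)%N, (0 < q)%N, (p < m)%N & (q < m)%N].
  by rewrite /q /p; split; lia.
have epq : (p + q = m)%N by rewrite subnKC // ltnW.
apply: (@runs_conseq _ _ _ _ _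
  ((1 + (1 + (neg_cost * (pw p + pw q) + (6 * (C + 22) + 8) * pw m))) + 1) _
  (0 + (0 + 0)) 0 (neg_post st m)) => //; last first.
  have := powR_half w2 m1; rewrite -/(pw p) -/(pw q) -/(pw m) => hp.
  have : neg_cost * (pw p + pw q) <= neg_cost * (5 / 9 * pw m) by rewrite ler_wpM2l.
  rewrite /neg_cost; nra.
apply: runs_if => /=; rewrite hm m1 // => _.
apply: runs_seq; apply: runs_iset; apply: runs_seq; apply: runs_iset.
rewrite -epq.
apply: runs_conseq (@runs_neg_split _ p q (IH _ pm p0) (IH _ qm q0) _ _ _ p0 q0) _ _ _ => //=.
- by rewrite hm.
- by rewrite hm.
- by rewrite hm.
Qed.

Lemma mxget_lapJ st n a b : (a < n)%N -> (b < n)%N ->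
  mxget (lapJ (amat st 0 n n)) a b =
  1 - rmem st 0%N a b + (if b == a then \sum_(l < n) rmem st 0%N a l else 0).
Proof.
move=> ha hb; rewrite (mxgetE _ (Ordinal ha) (Ordinal hb)) lapJE.
rewrite -val_eqE /= (eq_sym b); under eq_bigr => l _ do rewrite mxE /=.
rewrite mxE /=; case: ifP => _; ring.
Qed.

Lemma runs_try_build st n : imem st 0%N 0%N = n ->
  (forall i j, rmem st 3%N i j = 0) ->
  runs P orc
   (For 1 (ivar 0)
    (Seq (For 2 (ivar 0)
           (RSet 2 (ivar 1) (ivar 2) (RSub ROne (RGet 0 (ivar 1) (ivar 2)))))
    (Seq (For 2 (ivar 0)
           (RSet 2 (ivar 1) (ivar 1)
             (RAdd (RGet 2 (ivar 1) (ivar 1)) (RGet 0 (ivar 1) (ivar 2)))))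
         (RSet 3 (ivar 1) (ivar 1) ROne)))) st
   (n%:R * (((n%:R * (1 + 2) + 2) + ((n%:R * (1 + 2) + 2) + 1)) + 2) + 2)
   (n * (n * 0 + (n * 0 + 0)))
   (fun st' => [/\ imem st' 0%N 0%N = n, rmem st' 1%N = rmem st 1%N,
      amat st' 2 n n = lapJ (amat st 0 n n) & amat st' 3 n n = 1%:M]).
Proof.
move=> hn h3; set f := rmem st 0%N; set L := lapJ _.
pose base i st' := [/\ imem st' 0%N 0%N = n, imem st' 1%N 0%N = i,
   rmem st' 0%N = f, rmem st' 1%N = rmem st 1%N &
   (forall a b, (a < i)%N -> (b < n)%N -> rmem st' 2%N a b = mxget L a b) /\
   (forall a b, rmem st' 3%N a b = if (a == b) && (a < i)%N then 1 else 0)].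
apply: runs_conseq (_ : runs P orc _ st _ _ (base n)) _ _ _;
    [|exact: lexx|by []|]; last first.
  move=> st' [-> _ _ -> [h4 h5]]; split=> //; apply/matrixP => i j; rewrite mxE.
    by rewrite h4 // mxgetE.
  by rewrite h5 ltn_ord andbT mxE -val_eqE /=; case: eqP.
apply: (runs_for (Inv := base)).
- by move=> i st' [].
- move=> i st1 B1 im; apply: runs_seq.
  apply: runs_conseq (_ : runs P orc _ st1 _ _ (fun st' => [/\ base i st',
    imem st' 2%N 0%N = n & forall b, (b < n)%N -> rmem st' 2%N i b = 1 - f i b]))
    _ _ _; [|exact: lexx|by []|].
    apply: (runs_for (Inv := fun j st' => [/\ base i st', imem st' 2%N 0%N = j &
       forall b, (b < j)%N -> rmem st' 2%N i b = 1 - f i b])).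
    + by move=> j st' [[]].
    + move=> j st' [[e0 e1 e2 e3 [e4 e5]] e6 e7] jn; apply: runs_rset.
      rewrite /= e1 e6 e2; split; [split=> //|by rewrite /= addn1|].
        split=> // a b ai bn /=; rewrite (ltn_eqF ai) /=; exact: e4.
      move=> b; rewrite ltnS leq_eqVlt /= eqxx /=.
      by case: eqP => [-> //|_ /= /e7].
    + by case: B1 => *; split.
  move=> st2 [B2 _ e2]; apply: runs_seq.
  apply: runs_conseq (_ : runs P orc _ st2 _ _ (fun st' => [/\ base i st',
    imem st' 2%N 0%N = n & forall b, (b < n)%N -> rmem st' 2%N i b =
      1 - f i b + (if b == i then \sum_(l < n) f i l else 0)]))
    _ _ _; [|exact: lexx|by []|].
    apply: (runs_for (Inv := fun j st' => [/\ base i st', imem st' 2%N 0%N = j &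
       forall b, (b < n)%N -> rmem st' 2%N i b =
         1 - f i b + (if b == i then \sum_(l < j) f i l else 0)])).
    + by move=> j st' [[]].
    + move=> j st' [[e0 e1 e2' e3 [e4 e5]] e6 e7] jn; apply: runs_rset.
      rewrite /= e1 e6 e2'; split; [split=> //|by rewrite /= addn1|].
        split=> // a b ai bn /=; rewrite (ltn_eqF ai) /=; exact: e4.
      move=> b bn; rewrite big_ord_recr /= eqxx /=.
      case: eqP => [e|ne].
        by rewrite e e7 // eqxx addrA.
      by rewrite e7 //; case: eqP ne.
    + case: B2 => *; split=> // b bn; rewrite big_ord0 /= e2 //.
      by case: ifP; rewrite addr0.
  move=> st3 [[e0 e1 e2' e3 [e4 e5]] _ e7]; apply: runs_rset.
  rewrite /= e1 addn1; split=> //; split=> a b /=.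
    rewrite ltnS leq_eqVlt => /orP[/eqP -> bn|ai bn]; last exact: e4.
    by rewrite e7 // /L mxget_lapJ.
  rewrite e5; case: (eqVneq a i) => [->|ai] /=.
    by rewrite ltnSn andbT eq_sym; case: eqP; rewrite ?andbF // => _; rewrite ltnn andbF.
  by rewrite ltnS (leq_eqVlt a) (negPf ai).
- split=> //; split=> // a b /=; by rewrite h3 ltn0 andbF.
Qed.

Lemma runs_try_residual st n : imem st 0%N 0%N = n -> rmem st 1%N 0%N 0%N = 0 ->
  runs P orc
   (For 1 (ivar 0) (For 2 (ivar 0)
      (RSet 1 (ILit 0) (ILit 0)
        (RAdd (RGet 1 (ILit 0) (ILit 0))
              (RMul (RGet 4 (ivar 1) (ivar 2)) (RGet 4 (ivar 1) (ivar 2))))))) st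
   (n%:R * ((n%:R * (1 + 2) + 2) + 2) + 2) (n * (n * 0))
   (fun st' => rmem st' 0%N = rmem st 0%N /\
     rmem st' 1%N 0%N 0%N = \sum_(i < n) \sum_(j < n) (rmem st 4%N i j) ^+ 2).
Proof.
move=> hn h1; set g := rmem st 4%N.
pose base i j st' := [/\ imem st' 0%N 0%N = n, imem st' 1%N 0%N = i,
   rmem st' 0%N = rmem st 0%N, rmem st' 4%N = g &
   rmem st' 1%N 0%N 0%N = \sum_(a < i) \sum_(b < n) g a b ^+ 2
                          + \sum_(b < j) g i b ^+ 2].
apply: runs_conseq (_ : runs P orc _ st _ _ (base n 0%N)) _ _ _;
    [|exact: lexx|by []|]; last first.
  by move=> st' [_ _ -> _ ->]; rewrite big_ord0 addr0.
apply: (runs_for (Inv := fun i st' => base i 0%N st')).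
- by move=> i st' [].
- move=> i st1 B1 im.
  apply: runs_conseq (_ : runs P orc _ st1 _ _ (fun st' => base i n st' /\
    imem st' 2%N 0%N = n)) _ _ _; [|exact: lexx|by []|].
    apply: (runs_for (Inv := fun j st' => base i j st' /\ imem st' 2%N 0%N = j)).
    + by move=> j st' [[]].
    + move=> j st' [[e0 e1 e2 e3 e4] e5] jn; apply: runs_rset.
      split; last by rewrite /= e5 addn1.
      by split=> //=; rewrite e1 e5 e3 e4 big_ord_recr /= addrA -expr2.
    + by case: B1.
  move=> st2 [[e0 e1 e2 e3 e4] _]; split=> //=; first by rewrite e1 addn1.
  by rewrite e4 big_ord0 addr0 big_ord_recr.
- by split=> //=; rewrite !big_ord0 addr0.
Qed.

Definition try_cost : R := neg_cost + C + 50.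

Lemma runs_try_body st n : imem st 0%N 0%N = n -> (0 < n)%N ->
  (forall i j, rmem st 3%N i j = 0) -> rmem st 1%N 0%N 0%N = 0 ->
  let M := lapJ (amat st 0 n n) in
  runs P orc try_body st (try_cost * pw n) 0
   (fun st' => let X := amat st' 0 n n in
     [/\ 0 <= rmem st' 1%N 0%N 0%N,
         rmem st' 1%N 0%N 0%N = 0 <-> neg_inverse M X &
         posdef M -> neg_inverse M X]).
Proof.
move=> hn n0 h3 h1 M; rewrite /try_body.
have T1 : n%:R * n%:R <= pw n by rewrite -natrM; apply: natr_le_powR.
have T2 : n%:R <= pw n by apply: natr_le_powR; rewrite // leq_pmulr.
have T3 := powR_nat_ge1 n0.
apply: (@runs_conseq _ _ _ _ _
  ((n%:R * (((n%:R * (1 + 2) + 2) + ((n%:R * (1 + 2) + 2) + 1)) + 2) + 2) +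
   ((2 + 2 * (n%:R * n%:R) + neg_cost * pw n) + ((C + 22) * pw n +
   (n%:R * ((n%:R * (1 + 2) + 2) + 2) + 2)))) _
  (n * (n * 0 + (n * 0 + 0)) + (0 + (0 + n * (n * 0))))); [| |lia|by move=> ? h; exact: h]; last first.
  rewrite /try_cost; lra.
apply: runs_seq; apply: runs_conseq (runs_try_build hn h3) _ _ _ => //.
move=> s1 [e0 e1 e2 e3]; apply: runs_seq.
have d (s : state R) a : imem s 0%N 0%N = n -> block_dims s (corner_block a (ivar 0) (ivar 0)) n n by [].
apply: runs_conseq (runs_neg (st := s1) (em := ivar 0)
  (runs_neg_body n0) e0 (d s1 2%N e0) (d s1 0%N e0)) _ _ _ => //.
move=> _ [X -> hX]; set s2 := upd s1 _ _; apply: runs_seq.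
apply: runs_conseq (runs_fma (st := s2) (em := ivar 0) e0 n0 (leqnn n)
  (leqnn n) (leqnn n) (_ : block_cells s2 (corner_block 3 (ivar 0) (ivar 0)) <= _)%N (d s2 2%N e0) (d s2 0%N e0) (d s2 4%N e0)) _ _ _ => //.
  by rewrite /block_cells /= e0.
move=> _ ->; set s3 := upd s2 _ _.
rewrite !bmat_corner // in hX.
have E0 : amat s3 0 n n = X.
  by rewrite -(bmat_corner _ (r := ivar 0) (c := ivar 0)) // bmat_upd_disj // bmat_upd_same //; apply: d.
have E4 : amat s3 4 n n = 1%:M + M *m X.
  rewrite -(bmat_corner _ (r := ivar 0) (c := ivar 0)) // bmat_upd_same; last exact: d.
  rewrite bmat_upd_same; last exact: d.
  by rewrite !bmat_upd_disj // !bmat_corner // e2 e3.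
apply: runs_conseq (@runs_try_residual s3 n e0 _) _ _ _ => //.
  by rewrite /= /write_block /= e1.
move=> s4 [f0 f1] /=.
have -> : amat s4 0 n n = X by rewrite -E0; apply/matrixP => i j; rewrite !mxE f0.
have sq i : 0 <= \sum_(j < n) (rmem s3 4%N i j) ^+ 2.
  by apply: sumr_ge0 => j _; exact: sqr_ge0.
have Y (i j : 'I_n) : rmem s3 4%N i j = (1%:M + M *m X) i j.
  by rewrite -E4 mxE.
rewrite f1; split.
- by apply: sumr_ge0 => i _; exact: sq.
- split=> [/eqP|h]; last first.
    rewrite big1 // => i _; rewrite big1 // => j _.
    by rewrite Y (h : M *m X = _) subrr mxE expr0n.
  rewrite psumr_eq0 => [/allP H|i _]; last exact: sq.
  apply/eqP; rewrite -addr_eq0 addrC; apply/eqP/matrixP => i j.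
  have := H i (mem_index_enum i); rewrite implyTb psumr_eq0 => [/allP /(_ j)|k _]; last exact: sqr_ge0.
  by rewrite mem_index_enum implyTb sqrf_eq0 Y => /(_ isT) /eqP ->; rewrite mxE.
- by rewrite e2 in hX.
Qed.

End Procedures.

(** * The search *)

Section Digits.
Local Open Scope nat_scope.

Definition digit (s j l : nat) : nat := (j %/ s ^ l) %% s.

Lemma digits_exist (s k : nat) (d : nat -> nat) : (forall l, l < k -> d l < s) ->
  exists2 J, J < s ^ k & forall l, l < k -> digit s J l = d l.
Proof.
elim: k => [|k IH] h; first by exists 0.
have [J Jk HJ] := IH (fun l lk => h l (ltnW lk)).
have dk := h k (ltnSn k).
exists (J + d k * s ^ k); first by rewrite expnS; nia.
have s0 : 0 < s by lia.
move=> l; rewrite ltnS leq_eqVlt => /orP[/eqP ->|lk]; rewrite /digit.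
  by rewrite divnDMl ?expn_gt0 ?s0 // divn_small // modn_small.
have -> : s ^ k = s ^ (k - l) * s ^ l by rewrite -expnD subnK // ltnW.
rewrite -(HJ l lk) /digit mulnA.
rewrite divnDMl ?expn_gt0 ?s0 // addnC -(subnSK lk) expnSr mulnA.
by rewrite modnMDl.
Qed.

Section Successor.
Variables (s i j : nat).
Hypotheses (s0 : 0 < s) (dv : s ^ i %| j.+1).

(** The divisibility [dv] expresses that the carry reaches position [i], that is, the [i] lowest
    digits of [j] all equal [s - 1]. It is the loop invariant of [main_next]. *)
Lemma digit_carried l : l < i -> digit s j.+1 l = 0.
Proof.
move=> li; have /dvdnP[m ->] : s ^ l.+1 %| j.+1.
  by apply: dvdn_trans dv; apply: dvdn_exp2l.
by rewrite /digit expnS mulnA mulnK ?expn_gt0 ?s0 // modnMl.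
Qed.

Lemma divn_pred : j %/ s ^ i = (j.+1 %/ s ^ i).-1.
Proof.
have /dvdnP[[|m] e] := dv; first by [].
rewrite e mulnK ?expn_gt0 ?s0 //=.
have -> : j = m * s ^ i + (s ^ i).-1.
  have : 0 < s ^ i by rewrite expn_gt0 s0.
  by move: e; rewrite mulSn; lia.
by rewrite divnMDl ?expn_gt0 ?s0 // divn_small ?addn0 // prednK ?expn_gt0 ?s0.
Qed.

Lemma quotient_gt0 : 0 < j.+1 %/ s ^ i.
Proof. by rewrite divn_gt0 ?expn_gt0 ?s0 //; apply: dvdn_leq. Qed.

Lemma digit_carry : s <= digit s j i + 1 -> s ^ i.+1 %| j.+1.
Proof.
rewrite /digit divn_pred; have := quotient_gt0; set m := j.+1 %/ _ => m0 h.
have -> : j.+1 = m * s ^ i by rewrite divnK.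
rewrite expnS dvdn_pmul2r ?expn_gt0 ?s0 //.
rewrite -(prednK m0) -addn1 (divn_eq m.-1 s) -addnA.
have -> : m.-1 %% s + 1 = s by have := ltn_pmod m.-1 s0; lia.
by rewrite -mulSnr dvdn_mull.
Qed.

Lemma digit_succ : digit s j i + 1 < s ->
  digit s j.+1 i = digit s j i + 1 /\ forall l, i < l -> digit s j.+1 l = digit s j l.
Proof.
rewrite /digit; have E := divn_pred; have := quotient_gt0.
move: E; set m := j.+1 %/ s ^ i => E m0; rewrite E => h.
have em : m = m.-1 %/ s * s + (m.-1 %% s + 1).
  by rewrite addnA -divn_eq addn1 prednK.
split; first by rewrite {1}em modnMDl modn_small.
move=> l il; congr (_ %% _).
rewrite -(subnKC il) expnD !divnMA expnSr !divnMA -/m E; congr (_ %/ _).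
by rewrite {1}em divnMDl // (divn_small h) addn0.
Qed.

End Successor.

End Digits.

Lemma posdef_neg_inverse (R : realType) n (M : 'M[R]_n) :
  posdef M -> exists X, neg_inverse M X.
Proof.
move=> pd; suff uM : M \in unitmx by exists (- invmx M); rewrite /neg_inverse mulmxN mulmxV.
rewrite -row_free_unit -kermx_eq0; apply/eqP/row_matrixP => i; rewrite row0.
apply/eqP/negPn/negP => r0.
have := pd (row i (kermx M))^T; rewrite -(inj_eq trmx_inj) trmxK trmx0 => /(_ r0).
by rewrite /qform trmxK -row_mul mulmx_ker row0 mul0mx mxE ltxx.
Qed.

(** * Correctness and cost of the search *)

Section Reconstruction.
Variables (R : realType) (omega C : R) (Q : program).
Hypothesis w2 : 2 <= omega.
Hypothesis C0 : 0 <= C.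
Hypothesis hQ : multiplies_within omega C Q.
Variables (n s k : nat) (G : wgraph R n) (W : s.-tuple R).
Variable miss : k.-tuple ('I_n * 'I_n).
Hypotheses (n0 : (0 < n)%N) (cG : connected_graph G).
Hypotheses (Umiss : uniq miss) (Lmiss : forall e, e \in miss -> (e.1 < e.2)%N).
Hypothesis Wmiss : forall e, e \in miss -> adj G e.1 e.2 \in W.
Implicit Types (st : state R) (l : 'I_k).

Let P := reconstruct Q.
Let orc := effres_oracle G.
Let st0 := reconstruction_input G W miss.
Let pw : R := n%:R `^ omega.
Let U l : 'I_n := (tnth miss l).1.
Let V l : 'I_n := (tnth miss l).2.

Lemma missing_fst l : imem st0 1%N l = U l.
Proof.
rewrite /= (nth_map (tnth miss l)) ?size_tuple ?ltn_ord //.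
by rewrite -tnth_nth.
Qed.

Lemma missing_snd l : imem st0 2%N l = V l.
Proof.
rewrite /= (nth_map (tnth miss l)) ?size_tuple ?ltn_ord //.
by rewrite -tnth_nth.
Qed.

Lemma missing_lt l : (U l < V l)%N.
Proof. exact/Lmiss/mem_tnth. Qed.

(** Lets the work linear in [k] be absorbed into [n] to the power [omega]. *)
Lemma missing_count : (k <= n * n)%N.
Proof.
have := max_card (mem miss); rewrite card_prod !card_ord => h.
apply: leq_trans h; rewrite -[leqLHS](size_tuple miss).
by move/card_uniqP: Umiss => ->.
Qed.

Definition off_missing (f : nat -> nat -> R) : Prop := forall a b : 'I_n,
  (a, b) \notin miss -> (b, a) \notin miss -> f a b = adj G a b.

(** What every round preserves; the missing cells of array 0 are left free, since each candidate
    rewrites them. *)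
Definition frame st : Prop :=
  [/\ imem st 0%N = imem st0 0%N, imem st 1%N = imem st0 1%N,
      imem st 2%N = imem st0 2%N, rmem st 1%N = rmem st0 1%N
    & (forall l, rmem st 3%N l 0%N = effres G (U l) (V l)) /\
      off_missing (rmem st 0%N)].

Definition cand st l : R := rmem st0 1%N (imem st 3%N l) 0%N.

Definition filled (f : nat -> nat -> R) (c : 'I_k -> R) l : Prop :=
  f (U l) (V l) = c l /\ f (V l) (U l) = c l.

Lemma filled_tr (st : state R) (c : 'I_k -> R) : off_missing (rmem st 0%N) ->
  (forall l, filled (rmem st 0%N) c l) -> (amat st 0 n n)^T = amat st 0 n n.
Proof.
move=> off fl; apply/matrixP => a b; rewrite !mxE.
have [/tnthP[l e]|h1] := boolP ((a, b) \in miss).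
  by have := fl l; rewrite /filled /U /V -e /= => -[-> ->].
have [/tnthP[l e]|h2] := boolP ((b, a) \in miss).
  by have := fl l; rewrite /filled /U /V -e /= => -[-> ->].
rewrite !off //; first by rewrite -{1}(adj_tr G) mxE.
Qed.

Lemma filled_ge0 (st : state R) (c : 'I_k -> R) : off_missing (rmem st 0%N) ->
  (forall l, filled (rmem st 0%N) c l) -> (forall l, 0 <= c l) ->
  forall u v, 0 <= amat st 0 n n u v.
Proof.
move=> off fl c0 a b; rewrite !mxE.
have [/tnthP[l e]|h1] := boolP ((a, b) \in miss).
  by have := fl l; rewrite /filled /U /V -e /= => -[-> _].
have [/tnthP[l e]|h2] := boolP ((b, a) \in miss).
  by have := fl l; rewrite /filled /U /V -e /= => -[_ ->].
by rewrite off // adj_ge0.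
Qed.

Lemma filled_adj (st : state R) : off_missing (rmem st 0%N) ->
  (forall l, filled (rmem st 0%N) (fun l => adj G (U l) (V l)) l) ->
  amat st 0 n n = adj G.
Proof.
move=> off fl; apply/matrixP => a b; rewrite mxE.
have [/tnthP[l e]|h1] := boolP ((a, b) \in miss).
  by have := fl l; rewrite /filled /U /V -e /= => -[-> _].
have [/tnthP[l e]|h2] := boolP ((b, a) \in miss); last exact: off.
have := fl l; rewrite /filled /U /V -e /= => -[_ ->].
by rewrite -{1}(adj_tr G) mxE.
Qed.

(** Soundness: at each pair, the candidate and the true matrix agree or their resistances do, so
    [lapJ_pair_res_inj] applies. Off-diagonal entries can be read back, and the missing pairs are
    off the diagonal. *)
Lemma filled_unique (st : state R) (c : 'I_k -> R) X :
  off_missing (rmem st 0%N) -> (forall l, filled (rmem st 0%N) c l) ->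
  (forall l, 0 <= c l) -> neg_inverse (lapJ (amat st 0 n n)) X ->
  (forall l, effres G (U l) (V l) + pair_res X (U l) (V l) = 0) ->
  forall l, c l = adj G (U l) (V l).
Proof.
move=> off fl c0 iX res l.
have [X2 iX2] := posdef_neg_inverse (posdef_lapJ_adj cG).
have resE l' : pair_res X (U l') (V l') = pair_res X2 (U l') (V l').
  by have := res l'; rewrite (effres_neg_inverse _ _ iX2) => /eqP; rewrite addrC subr_eq0 => /eqP.
have E : lapJ (amat st 0 n n) = lapJ (adj G).
  apply: (lapJ_pair_res_inj (filled_tr off fl) (adj_tr G)
    (filled_ge0 off fl c0) (adj_ge0 G) iX iX2) => a b.
  have [/tnthP[l' e]|h1] := boolP ((a, b) \in miss).
    by right; have := resE l'; rewrite /U /V -e.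
  have [/tnthP[l' e]|h2] := boolP ((b, a) \in miss).
    right; have := resE l'; rewrite /U /V -e /pair_res /= => h.
    by move: h; rewrite (addrC (X b b)) (addrC (X2 b b)) -!addrA
      (addrC (- X b a)) (addrC (- X2 b a)).
  by left; rewrite mxE off.
rewrite -(lapJ_offdiag E); last by rewrite neq_ltn missing_lt.
by rewrite mxE; have [-> _] := fl l.
Qed.

Lemma runs_fill st : frame st ->
  runs P orc main_fill st (k%:R * ((1 + (1 + 1)) + 2) + 2) (k * (0 + (0 + 0)))
   (fun st' => [/\ frame st', imem st' 3%N = imem st 3%N,
      (forall l, filled (rmem st' 0%N) (cand st) l)
      & forall l, rmem st' 2%N l 0%N = cand st l]).
Proof.
move=> F0.
pose Inv (i : nat) st' := [/\ frame st', imem st' 3%N = imem st 3%N,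
  imem st' 4%N 0%N = i, (forall l, (l < i)%N -> filled (rmem st' 0%N) (cand st) l)
  & forall l, (l < i)%N -> rmem st' 2%N l 0%N = cand st l].
apply: runs_conseq (_ : runs P orc _ st _ _ (Inv k)) _ _ _;
    [|exact: lexx|by []|]; last first.
  by move=> st' [h1 h2 _ h4 h5]; split=> // l; [apply: h4|apply: h5].
apply: (runs_for (Inv := Inv)).
- move=> i st' [[e0 _ _ _ _] _ e4 _ _]; split=> //=.
  by rewrite e0 /= size_tuple.
- move=> i st' [[e0 e1 e2 e3 [e4 e5]] f1 f2 f3 f4] ik.
  apply: runs_seq; apply: runs_rset; apply: runs_seq; apply: runs_rset.
  apply: runs_rset; rewrite /= f2 f1 e1 e2 e3.
  set L := Ordinal ik; set w := rmem st0 1%N _ _.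
  have -> : imem st0 1%N i = U L by rewrite (missing_fst L).
  have -> : imem st0 2%N i = V L by rewrite (missing_snd L).
  have wE : w = cand st L by [].
  split=> //=.
  + split=> //; split=> // a b h1 h2 /=.
    rewrite !val_eqE; case: ifP => [/andP[/eqP ea /eqP eb]|_].
      by move: h2; rewrite ea eb /U /V -surjective_pairing mem_tnth.
    case: ifP => [/andP[/eqP ea /eqP eb]|_]; last exact: e5.
    by move: h1; rewrite ea eb /U /V -surjective_pairing mem_tnth.
  + by rewrite addn1.
  + move=> l; rewrite ltnS /filled /= !val_eqE => li.
    (* One write goes above the diagonal and its mirror below, so they never collide; [ne2] uses
       that the pairs are distinct. *)
    have lV : (U l == V L) && (V l == U L) = false.
      apply/negP => /andP[/eqP a /eqP b].
      by have := missing_lt l; have := missing_lt L; rewrite a b; lia.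
    have lV' : (V l == U L) && (U l == V L) = false by rewrite andbC.
    rewrite lV; have [->|ne] := eqVneq l L.
      by rewrite !eqxx.
    have ne2 : (U l == U L) && (V l == V L) = false.
      apply/negP => /andP[/eqP a /eqP b]; move/eqP: ne; apply.
      have /tuple_uniqP inj := Umiss; apply: inj.
      by rewrite [LHS]surjective_pairing [RHS]surjective_pairing -/(U l) -/(U L) -/(V l) -/(V L) a b.
    have ne3 : (V l == V L) && (U l == U L) = false by rewrite andbC.
    rewrite ne2 ne3 lV'; apply: f3.
    by rewrite ltn_neqAle li andbT; apply: contra_neq ne => h; apply: val_inj.
  + move=> l; rewrite ltnS leq_eqVlt andbT => /orP[/eqP li|li].
      by rewrite li eqxx wE; congr cand; apply: val_inj.
    by rewrite (ltn_eqF li) f4.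
- by case: F0 => *; split.
Qed.

Lemma runs_check st : frame st -> 0 <= rmem st 5%N 0%N 0%N ->
  runs P orc main_check st (k%:R * ((1 + (1 + 1)) + 2) + 2) (k * (0 + 0))
   (fun st' => [/\ frame st', imem st' 3%N = imem st 3%N,
      rmem st' 2%N = rmem st 2%N, 0 <= rmem st' 5%N 0%N 0%N &
      rmem st' 5%N 0%N 0%N = 0 <-> rmem st 5%N 0%N 0%N = 0 /\
        forall l, effres G (U l) (V l) + pair_res (amat st 4 n n) (U l) (V l) = 0
           /\ 0 <= cand st l]).
Proof.
move=> F0 acc0.
pose ok l := effres G (U l) (V l) + pair_res (amat st 4 n n) (U l) (V l) = 0
           /\ 0 <= cand st l.
pose Inv (i : nat) st' := [/\ frame st', imem st' 3%N = imem st 3%N,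
  imem st' 4%N 0%N = i, rmem st' 4%N = rmem st 4%N &
  [/\ rmem st' 2%N = rmem st 2%N, 0 <= rmem st' 5%N 0%N 0%N &
   rmem st' 5%N 0%N 0%N = 0 <-> rmem st 5%N 0%N 0%N = 0 /\
     forall l, (l < i)%N -> ok l]].
apply: runs_conseq (_ : runs P orc _ st _ _ (Inv k)) _ _ _;
    [|exact: lexx|by []|]; last first.
  move=> st' [h1 h2 _ _ [h3 h4 h5]]; split=> //; rewrite h5.
  by split=> -[-> h]; split=> // l; [apply: h|move=> _; apply: h].
apply: (runs_for (Inv := Inv)).
- move=> i st' [[e0 _ _ _ _] _ e4 _ _]; split=> //=.
  by rewrite e0 /= size_tuple.
- move=> i st' [[e0 e1 e2 e3 [e4 e5]] f1 f2 f3 [f4 f5 f6]] ik.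
  set L := Ordinal ik.
  have okS : (forall l, (l < i.+1)%N -> ok l) <-> ((forall l, (l < i)%N -> ok l) /\ ok L).
    split=> [h|[h1 h2] l]; first by split=> [l li|]; apply: h; rewrite //= ltnW.
    rewrite ltnS leq_eqVlt => /orP[/eqP li|/h1 //].
    by have -> : l = L by apply: val_inj.
  have eU : imem st0 1%N i = U L by rewrite (missing_fst L).
  have eV : imem st0 2%N i = V L by rewrite (missing_snd L).
  apply: runs_seq; apply: runs_rset; rewrite /= f2 e1 e2 eU eV f3 (e4 L).
  set d := effres G _ _ + _.
  have dE : d = effres G (U L) (V L) + pair_res (amat st 4 n n) (U L) (V L).
    by rewrite /d /pair_res !mxE.
  have d0 : 0 <= d * d by rewrite -expr2 sqr_ge0.
  have [|] := boolP (cand st L < 0) => hc.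
    apply: runs_if => /=; rewrite f2 f1 e3 => hc'; last by rewrite [_ < 0]hc in hc'.
    apply: runs_rset => /=; split=> //=; first by rewrite f2 addn1.
    split=> //; first by lra.
    (* Both sides are false: the accumulator is at least 1 and the candidate weight is negative. *)
    split=> [h|[_ /okS[_ [_ h]]]]; exfalso; lra.
  apply: runs_if => /=; rewrite f2 f1 e3 => hc'; first by rewrite [_ < 0](negPf hc) in hc'.
  apply: runs_skip => /=; split=> //=; first by rewrite f2 addn1.
  split=> //; first by rewrite addr_ge0.
  rewrite okS; split=> [/eqP|[a0 [h [h1 _]]]].
    rewrite paddr_eq0 // mulf_eq0 orbb => /andP[/eqP /f6 [-> h] /eqP dd].
    by split=> //; split=> //; split; [rewrite -dE|rewrite leNgt].
  have -> : d = 0 by rewrite dE.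
  by rewrite mulr0 addr0; apply/f6.
- case: F0 => *; split=> //; split=> //=.
  by split=> [->|[]//].
Qed.

Lemma runs_next st j : frame st -> (0 < k -> 0 < s)%N ->
  (forall l, imem st 3%N l = digit s j l) ->
  runs P orc main_next st (1 + ((k%:R * ((1 + 1) + 1) + 1) + 1)) (0 + (0 + 0))
   (fun st' => [/\ frame st', rmem st' = rmem st
      & forall l, imem st' 3%N l = digit s j.+1 l]).
Proof.
move=> F0 s0 dig.
pose Inv (i : nat) st' := [/\ frame st', rmem st' = rmem st,
  imem st' 4%N 0%N = i, (i <= k)%N & (s ^ i %| j.+1)%N /\
  forall l, imem st' 3%N l = if (l < i)%N then 0%N else digit s j l].
apply: runs_seq; apply: runs_iset; apply: runs_seq.
apply: runs_conseq (@runs_while _ P orc _ _ _ (1 + 1) k Inv _ _ _) _ _ _ => //.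
- by rewrite addr_ge0.
- move=> i st' [[e0 e1 e2 e3 e4] e5 e6 e7 [e8 e9]] /=; rewrite e6 e0 /= !size_tuple.
  case/andP=> ik; rewrite -leqNgt; set L := Ordinal ik.
  rewrite (e9 L) /= ltnn => hd; split=> //.
  have sp := s0 (leq_ltn_trans (leq0n i) ik).
  rewrite -[0%N]/(0 + 0)%N; apply: runs_seq; apply: runs_iset; apply: runs_iset.
  split=> //=; first by rewrite e6 addn1.
  split; first exact: digit_carry.
  move=> l; rewrite e6 ltnS; case: (ltngtP l i) => [li|li|_] //=.
    by rewrite e9 li.
  by rewrite e9 ltnNge (ltnW li).
- move=> st' [hb [i [[e0 e1 e2 e3 e4] e5 e6 e7 [e8 e9]]]].
  apply: runs_iset; rewrite /= e6.
  move: hb; rewrite /= e6 e0 /= !size_tuple negb_and negbK -leqNgt => hb.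
  split=> // l /=.
  have sp := s0 (leq_ltn_trans (leq0n l) (ltn_ord l)).
  case: (ltngtP l i) => [li|li|li] /=.
  + by rewrite e9 li (digit_carried sp e8 li).
  + rewrite e9 ltnNge (ltnW li) /=.
    have ik : (i < k)%N := ltn_trans li (ltn_ord l).
    move: hb; rewrite leqNgt ik /= (e9 (Ordinal ik)) /= ltnn => hb.
    by have [_ ->] := digit_succ sp e8 hb.
  + have ik : (i < k)%N by rewrite -li.
    move: hb; rewrite leqNgt ik /= (e9 (Ordinal ik)) /= ltnn => hb.
    by rewrite li; have [-> _] := digit_succ sp e8 hb.
Qed.

Let step_cost : R := try_cost C + 30.

(** The last two conclusions are soundness, from uniqueness, and completeness, from positive
    definiteness at the true weights. *)
Lemma runs_step st j : frame st -> (0 < k -> 0 < s)%N ->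
  (forall l, imem st 3%N l = digit s j l) ->
  runs P orc main_step st (step_cost * pw) 0
   (fun st' => [/\ frame st', forall l, imem st' 3%N l = digit s j.+1 l,
      0 <= rmem st' 5%N 0%N 0%N,
      rmem st' 5%N 0%N 0%N = 0 ->
        forall l, rmem st' 2%N l 0%N = adj G (U l) (V l)
      & (forall l, cand st l = adj G (U l) (V l)) ->
        rmem st' 5%N 0%N 0%N = 0]).
Proof.
move=> F0 s0 dig; rewrite /main_step.
have T1 : n%:R * n%:R <= pw by rewrite -natrM; apply: natr_le_powR.
have T2 : k%:R <= pw by apply: natr_le_powR => //; exact: missing_count.
have T3 : 1 <= pw by apply: powR_nat_ge1.
apply: (@runs_conseq _ _ _ _ _
  ((k%:R * ((1 + (1 + 1)) + 2) + 2) + ((3 + 2 * (n%:R * n%:R) + 1 + try_cost C * pw)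
  + ((k%:R * ((1 + (1 + 1)) + 2) + 2) + (1 + ((k%:R * ((1 + 1) + 1) + 1) + 1))))) _
  (k * (0 + (0 + 0)) + (0 + (k * (0 + 0) + (0 + (0 + 0)))))); [| |lia|by move=> ? h; exact: h]; last first.
  rewrite /step_cost; lra.
apply: runs_seq; apply: runs_conseq (runs_fill F0) _ _ _ => //.
move=> s1 [F1 d1 fl1 out1]; apply: runs_seq.
have hn : ieval s1 (ivar 0) = n by case: F1 => /= ->.
set cs := call_state s1 [:: ivar 0] [:: corner_block 0 (ivar 0) (ivar 0)].
have A1 : amat cs 0 n n = amat s1 0 n n by rewrite amat_call bmat_corner.
have z (x y a : nat) : nth (fun _ _ : nat => 0 : R) [::] a x y = 0 by rewrite nth_nil.
have try := @runs_try_body _ _ _ _ w2 C0 hQ orc cs n hn n0 (fun i j => z i j 2%N) (z 0%N 0%N 0%N).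
rewrite /= A1 in try.
pose outs := [:: corner_block 4 (ivar 0) (ivar 0); corner_block 5 (ILit 1) (ILit 1)].
apply: runs_conseq (runs_call (f := 1) (ia := [:: ivar 0])
  (ins := [:: corner_block 0 (ivar 0) (ivar 0)]) (outs := outs)
  (T := try_cost C * pw) (q := 0%N) (P := P) (orc := orc) (st := s1)
  (Post := fun s2 => exists2 st', s2 = return_state s1 st' outs &
     let X := amat st' 0 n n in
     [/\ 0 <= rmem st' 1%N 0%N 0%N,
         rmem st' 1%N 0%N 0%N = 0 <-> neg_inverse (lapJ (amat s1 0 n n)) X &
         posdef (lapJ (amat s1 0 n n)) -> neg_inverse (lapJ (amat s1 0 n n)) X]) _) _ _ _ => //.
- by apply: runs_conseq try _ _ _ => // st' h; exists st'.
- rewrite lerD2r /blocks_cells /block_cells /= (hn : imem s1 0%N 0%N = n).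
  rewrite !addn0 -natr1 !natrD !natrM; lra.
move=> _ [st' -> [acc0 accE accP]]; set s2 := return_state _ _ _.
have F2 : frame s2 by case: F1.
have X2 : amat s2 4 n n = amat st' 0 n n.
  apply/matrixP => a b; rewrite !mxE /s2 /= /write_block /= (hn : imem s1 0%N 0%N = n).
  by rewrite !add0n !ltn_ord !subn0.
have acc2 : rmem s2 5%N 0%N 0%N = rmem st' 1%N 0%N 0%N by [].
have c2 l : cand s2 l = cand st l by rewrite /cand -d1.
apply: runs_seq.
apply: runs_conseq (@runs_check s2 F2 _) _ _ _ => //.
move=> s3 [F3 d3 out3 acc3 accE3].
have dig3 l : imem s3 3%N l = digit s j l by rewrite d3 /= d1 dig.
apply: runs_conseq (runs_next F3 s0 dig3) _ _ _ => //.
move=> s4 [F4 r4 dig4].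
have off1 : off_missing (rmem s1 0%N) by case: F1 => _ _ _ _ [].
split=> //; rewrite r4 //.
- move/accE3 => [/accE iX h] l; rewrite out3 [LHS]out1.
  apply: (filled_unique off1 fl1 _ iX) => l'.
    by have [_] := h l'; rewrite c2.
  by have [] := h l'; rewrite X2.
- move=> hc; apply/accE3.
  have cE : cand st = fun l => adj G (U l) (V l) by apply/funext.
  have A1E : amat s1 0 n n = adj G by apply: filled_adj; rewrite // -cE.
  rewrite A1E in accE accP; have iX := accP (posdef_lapJ_adj cG).
  split; first exact/accE.
  move=> l; rewrite X2 c2 hc adj_ge0; split=> //.
  by rewrite (effres_neg_inverse _ _ iX) addNr.
Qed.

Lemma runs_main : exists (st : state R) (t : nat),
  [/\ run P orc st0 st t k,
      forall l, rmem st 2%N l 0%N = adj G (U l) (V l)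
    & t%:R <= (step_cost + 8) * s%:R ^+ k * pw].
Proof.
have T2 : k%:R <= pw by apply: natr_le_powR => //; exact: missing_count.
have T3 : 1 <= pw by apply: powR_nat_ge1.
have s0 : (0 < k -> 0 < s)%N.
  move=> k0; have := Wmiss (mem_tnth (Ordinal k0) miss).
  by case: (s) (W) => // W0; rewrite tuple0.
(* The digits of [J] are the positions of the true weights in [W], so [J] is the number of a correct
   candidate and at most [J.+1] rounds, hence at most [s ^ k], take place. *)
pose d (i : nat) : nat := if insub i is Some l then index (adj G (U l) (V l)) W else 0%N.
have [J Js HJ] : exists2 J, (J < s ^ k)%N & forall i, (i < k)%N -> digit s J i = d i.
  apply: digits_exist => i ik; rewrite /d insubT.
  by rewrite -[X in (_ < X)%N](size_tuple W) index_mem Wmiss // mem_tnth.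
have candJ st : (forall l, imem st 3%N l = digit s J l) ->
    forall l, cand st l = adj G (U l) (V l).
  move=> h l; rewrite /cand h HJ // /d valK /= nth_index //.
  exact/Wmiss/mem_tnth.
have sc0 : 0 <= step_cost by rewrite /step_cost /try_cost /neg_cost; have := C0; lra.
(* While the residual is positive, candidate [J] has not been passed: a round at [J] would have
   brought it to zero. *)
pose Inv j st := [/\ frame st, forall l, imem st 3%N l = digit s j l &
  (0 < rmem st 5%N 0%N 0%N /\ (j <= J)%N) \/ (rmem st 5%N 0%N 0%N = 0 /\
     forall l, rmem st 2%N l 0%N = adj G (U l) (V l))].
suff [st [t [h1 h2 h3]]] : runs P orc main_body st0
    ((k%:R * (1 + 2) + 2) + (1 + (J.+1%:R * (step_cost * pw + 1) + 1))) (k * 1 + (0 + 0))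
    (fun st => forall l, rmem st 2%N l 0%N = adj G (U l) (V l)).
  exists st, t; split=> //; first by rewrite !addn0 muln1 in h1.
  apply: le_trans h2 _.
  have N1 : (J.+1%:R : R) <= s%:R ^+ k by rewrite -natrX ler_nat.
  have S1 : (1 : R) <= s%:R ^+ k by apply: le_trans N1; rewrite ler1n.
  move: (s%:R ^+ k) N1 S1 => S N1 S1.
  have h4 : J.+1%:R * (step_cost * pw + 1) <= S * (step_cost * pw + 1).
    by apply: ler_wpM2r => //; rewrite addr_ge0 // mulr_ge0 //; lra.
  have h5 : S <= S * pw by rewrite ler_peMr //; lra.
  have h6 : pw <= S * pw by rewrite ler_peMl //; lra.
  (* The 8 splits as 3 for the loop over the [k] queries, 4 for constant overhead and 1 for the loop
     test paid per candidate. *)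
  have -> : (step_cost + 8) * S * pw = S * (step_cost * pw) + 8 * (S * pw) by ring.
  have := h4; rewrite mulrDr mulr1; lra.
apply: runs_seq.
apply: runs_conseq (@runs_for _ P orc 4 (IGet 0 (ILit 2)) _ _ 1 1 k
  (fun i st => [/\ imem st 4%N 0%N = i, (forall a, a != 4%N -> imem st a = imem st0 a),
    (forall a, a != 3%N -> rmem st a = rmem st0 a)
    & forall l, (l < i)%N -> rmem st 3%N l 0%N = effres G (U l) (V l)]) _ _ _) _ _ _ => //.
- by move=> i st [e1 e2 _ _]; split=> //; rewrite /= e2 //= size_tuple.
- move=> i st [e1 e2 e3 e4] ik; apply: runs_query.
  set L := Ordinal ik; split=> [|a a4|a a3|l]; first by rewrite /= e1 addn1.
  + by rewrite -e2 //; apply/funext => x; rewrite /= (negPf a4).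
  + rewrite -e3 //; apply/funext => x; apply/funext => y.
    by rewrite /= (negPf a3).
  + rewrite ltnS leq_eqVlt => /orP[/eqP li|li]; last first.
      by rewrite /= e1 (ltn_eqF li) e4.
    have -> : l = L by apply: val_inj.
    rewrite [LHS]/= e1 !e2 // eqxx (_ : imem st0 1%N i = U L); last exact: (missing_fst L).
    rewrite (_ : imem st0 2%N i = V L); last exact: (missing_snd L).
    by rewrite /orc /effres_oracle !valK.
- split=> // a a4 /=; apply/funext => x; by rewrite (negPf a4).
move=> s1 [_ e2 e3 e4]; apply: runs_seq; apply: runs_rset; set s2 := rset _ _ _ _ _.
apply: runs_conseq (@runs_while _ P orc _ _ s2 (step_cost * pw) J.+1 Inv _ _ _) _ _ _ => //.
- by rewrite mulr_ge0 //; lra.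
- move=> j st [F dg h] /= acc.
  case: h => [[_ jJ]|[a0 _]]; last by rewrite a0 ltxx in acc.
  split=> //; apply: runs_conseq (runs_step F s0 dg) _ _ _ => //.
  move=> st' [F' dg' a' out' ok']; split=> //.
  have [a0|a0] := eqVneq (rmem st' 5%N 0%N 0%N) 0; first by right; split=> //; apply: out'.
  left; split; first by rewrite lt0r a0.
  rewrite ltn_neqAle jJ andbT; apply: contra_neq a0 => jE; apply: ok'.
  by apply: candJ; rewrite -jE.
- split.
  + split; try by rewrite /= e2. by rewrite /= e3.
    split; first by move=> l; rewrite /= e4.
    move=> a b h1 h2; rewrite /= e3 //= /mx_array !valK mxE.
    by rewrite (negPf h1) (negPf h2).
  + by move=> l; rewrite /= e2 //= /digit div0n mod0n.
  + by left; split=> //=; exact: ltr01.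
- move=> st [/= nb [j [F dg [[a0 _]|[_ //]]]]].
  by rewrite a0 in nb.
Qed.

End Reconstruction.

Theorem mainTheorem15 (R : realType) (omega : R)
    (homega : matmul_exponent omega) :
  exists (P : program) (C : R),
    forall (n s k : nat) (G : wgraph R n) (W : s.-tuple R)
      (miss : k.-tuple ('I_n * 'I_n)),
    (0 < n)%N -> connected_graph G ->
    uniq W -> (forall u v : 'I_n, edge G u v -> weight G u v \in W) ->
    uniq miss -> (forall e, e \in miss -> (e.1 < e.2)%N) ->
    (forall e, e \in miss -> adj G e.1 e.2 \in W) ->
    exists (st : state R) (t : nat),
      [/\ run P (effres_oracle G) (reconstruction_input G W miss) st t k,
          forall i : 'I_k,
            rmem st 2%N i 0%N = adj G (tnth miss i).1 (tnth miss i).2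
        & t%:R <= C * s%:R ^+ k * n%:R `^ omega].
Proof.
have w2 := matmul_exponent_ge2 homega.
have [Q [C hQ]] := homega.
(* At [n = 1] the bound reads [t <= C]. *)
have C0 : 0 <= C.
  have [st [t [_ _ h]]] := hQ (fun _ _ => 0) 1%N 0 0 isT.
  by move: h; rewrite powR1 mulr1; apply: le_trans; exact: ler0n.
exists (reconstruct Q), (try_cost C + 30 + 8) => n s k G W miss n0 cG _ _ um lm wm.
exact: runs_main w2 C0 hQ n s k G W miss n0 cG um lm wm.
Qed.
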